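(* Let $A$ be a noetherian commutative ring and $M$ an $A$-module. Then $M$ satisfies Property $(\mathsf{L}_2)$ if and only if $M$ has Loewy dimension $\le 1$.
   Context: An $A$-module $M$ satisfies Property $(\mathsf{L}_2)$ if for every artinian quotient $Q$ of $M$, the poset of submodules of $Q$ (ordered by inclusion) does not contain any chain isomorphic to the ordinal $\omega^2$. Loewy dimension. An artinian $A$-module $Q$ decomposes canonically as a finite direct sum $Q=\bigoplus_{\mathfrak{M}}Q(\mathfrak{M})$ over its associated primes $\mathfrak{M}$ (which are maximal ideals of $A$), where $Q(\mathfrak{M})\simeq Q\otimes_A A_{\mathfrak{M}}$ has $\mathfrak{M}$ as only associated prime and is naturally an artinian module over the completion $\widehat{A_{\mathfrak{M}}}$. For a complete noetherian local ring $R$, with $E$ an injective hull of its residual field, the Matlis dual of an $R$-module $V$ is $T(V)=\mathrm{Hom}_R(V,E)$; if $V$ is artinian, $T(V)$ is finitely generated. The Loewy dimension of the artinian module $Q$ is the supremum over $\mathfrak{M}$ of the Krull dimension of the Matlis dual of $Q(\mathfrak{M})$ (as $\widehat{A_{\mathfrak{M}}}$-module); the Loewy dimension of $\{0\}$ is $-\infty$. The Loewy dimension of an arbitrary $A$-module $M$ is the supremum of the Loewy dimensions of all artinian quotients of $M$ (if infinite, this is $\omega$). *)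

(* Defs.v *)
From HB Require Import structures.
From mathcomp Require Import all_boot all_order all_algebra.
From mathcomp Require Import all_classical constructive_ereal.
From mathcomp Require Import generic_quotient ring_quotient ring.
Set Implicit Arguments.
Unset Strict Implicit.
Unset Printing Implicit Defensive.
Import Order.TTheory GRing.Theory Num.Theory.
Local Open Scope classical_set_scope.
Local Open Scope ring_scope.
Local Open Scope quotient_scope.

Definition is_submodule (A : pzRingType) (M : lmodType A) (N : set M) : Prop :=
  [/\ N 0, forall x y, N x -> N y -> N (x + y) & forall a x, N x -> N (a *: x)].

Definition artinian (A : pzRingType) (M : lmodType A) : Prop :=
  forall N : nat -> set M, (forall n, is_submodule (N n)) ->
    (forall n, N n.+1 `<=` N n) -> exists n, forall m, (n <= m)%N -> N m = N n.

Definition noetherian (A : pzRingType) (M : lmodType A) : Prop :=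
  forall N : nat -> set M, (forall n, is_submodule (N n)) ->
    (forall n, N n `<=` N n.+1) -> exists n, forall m, (n <= m)%N -> N m = N n.

Definition noetherian_ring (A : comPzRingType) : Prop := noetherian A^o.

Definition is_ideal (A : comPzRingType) (I : set A) : Prop :=
  is_submodule (I : set A^o).

Definition prime_ideal (A : comPzRingType) (P : set A) : Prop :=
  [/\ is_ideal P, ~ P 1 & forall a b, P (a * b) -> P a \/ P b].

Definition maximal_ideal (A : comPzRingType) (P : set A) : Prop :=
  [/\ is_ideal P, ~ P 1 &
    forall J, is_ideal J -> P `<=` J -> J = P \/ J = setT].

Record maxIdeal (A : comPzRingType) := MaxIdeal {
  max_ideal_set :> set A;
  max_idealP : maximal_ideal max_ideal_set
}.

Definition ideal_mul (A : comPzRingType) (I J : set A) : set A :=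
  smallest (@is_ideal A) [set i * j | i in I & j in J].

Definition ideal_pow (A : comPzRingType) (I : set A) (n : nat) : set A :=
  iter n (ideal_mul I) setT.

Definition annihilator (A : comPzRingType) (M : lmodType A) : set A :=
  [set a | forall x : M, a *: x = 0].

Definition associated_prime (A : comPzRingType) (M : lmodType A) (P : set A) :
    Prop :=
  prime_ideal P /\ exists x : M, P = [set a | a *: x = 0].

(* The ordinal omega^2 is [nat * nat] with the lexicographic order, (i, j)
   standing for omega * i + j. *)
Definition has_omega2_chain (A : pzRingType) (M : lmodType A) : Prop :=
  exists c : nat *l nat -> set M, (forall p, is_submodule (c p)) /\
    (forall p q, (p <= q)%O <-> c p `<=` c q).

Definition property_L2 (A : comPzRingType) (M : lmodType A) : Prop :=
  forall (Q : lmodType A) (f : {linear M -> Q}), (forall y, exists x, f x = y) ->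
    artinian Q -> ~ has_omega2_chain Q.

Section IdealFacts.
Variable A : comPzRingType.
Implicit Types (I J : set A) (P : maxIdeal A).

Lemma ideal0 I : is_ideal I -> I 0. Proof. by case. Qed.
Lemma idealD I x y : is_ideal I -> I x -> I y -> I (x + y).
Proof. by move=> [_ h _]; apply: h. Qed.
Lemma idealMl I a x : is_ideal I -> I x -> I (a * x).
Proof. by move=> [_ _ h]; apply: (h a). Qed.
Lemma idealN I x : is_ideal I -> I x -> I (- x).
Proof. by move=> Ii Ix; rewrite -mulN1r; apply: idealMl. Qed.
Lemma idealB I x y : is_ideal I -> I x -> I y -> I (x - y).
Proof. by move=> Ii Ix Iy; apply: idealD => //; apply: idealN. Qed.

Lemma ideal_setT : is_ideal (@setT A). Proof. by split. Qed.

Lemma ideal_mul_ideal I J : is_ideal (ideal_mul I J).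
Proof.
split=> [K [Ki _]|x y hx hy K KK|a x hx K KK].
- exact: ideal0.
- by apply: idealD; [case: KK|exact: hx|exact: hy].
- by apply: idealMl; [case: KK|exact: hx].
Qed.

Lemma ideal_pow_ideal I n : is_ideal (ideal_pow I n).
Proof. by case: n => [|n]; [exact: ideal_setT|exact: ideal_mul_ideal]. Qed.

Lemma ideal_mul_subr I J : is_ideal J -> ideal_mul I J `<=` J.
Proof.
move=> Ji; apply: smallest_sub => // _ [i _ [j Jj <-]]; exact: idealMl.
Qed.

Lemma ideal_mulM I J i j : I i -> J j -> ideal_mul I J (i * j).
Proof.
by move=> Ii Jj K [_]; apply; exists i => //; exists j.
Qed.

Lemma ideal_pow_le I m n : (m <= n)%N -> ideal_pow I n `<=` ideal_pow I m.
Proof.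
elim: n => [|n IHn]; first by rewrite leqn0 => /eqP->.
rewrite leq_eqVlt => /orP[/eqP->//|/IHn h] x hx; apply: h.
exact: (ideal_mul_subr (ideal_pow_ideal I n)) hx.
Qed.

Lemma max_ideal_ideal P : is_ideal P. Proof. by case: (max_idealP P). Qed.

Lemma max_ideal_nP1 P : ~ (P : set A) 1. Proof. by case: (max_idealP P). Qed.

Lemma max_ideal_inv P s : ~ (P : set A) s ->
  exists t, (P : set A) (1 - t * s).
Proof.
move=> Ps.
have Pi := max_ideal_ideal P.
pose J : set A := [set x | exists t, (P : set A) (x - t * s)].
have Ji : is_ideal J.
  split.
  - by exists 0; rewrite mul0r subr0; exact: ideal0.
  - move=> x y [t ht] [u hu]; exists (t + u).
    by rewrite mulrDl opprD addrACA; exact: idealD.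
  - move=> a x [t ht]; exists (a * t).
    by rewrite -mulrA -mulrBr; exact: idealMl.
have PJ : (P : set A) `<=` J.
  by move=> x Px; exists 0; rewrite mul0r subr0.
have [_ _ /(_ _ Ji PJ)[JP|JT]] := max_idealP P.
- case: Ps; rewrite -JP; exists 1; rewrite mul1r subrr; exact: ideal0.
- by have : J 1 by rewrite JT.
Qed.

Lemma max_ideal_prime P : prime_ideal P.
Proof.
split; [exact: max_ideal_ideal|exact: max_ideal_nP1|move=> a b Pab].
have [Pa|/max_ideal_inv[t ht]] := pselect ((P : set A) a); first by left.
right; have -> : b = (1 - t * a) * b + t * (a * b).
  by rewrite mulrBl mul1r mulrA subrK.
have Pi := max_ideal_ideal P.
by apply: idealD => //; [rewrite mulrC|]; exact: idealMl.
Qed.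

Lemma max_idealNM P s t :
  ~ (P : set A) s -> ~ (P : set A) t -> ~ (P : set A) (s * t).
Proof. by move=> hs ht; have [_ _ h] := max_ideal_prime P; case/h. Qed.

(* Elements outside of [P] are invertible modulo every power of [P]. *)
Lemma max_ideal_pow_inv P n s : ~ (P : set A) s ->
  exists t, ideal_pow P n (1 - t * s).
Proof.
move=> /max_ideal_inv[t ht]; elim: n => [|n [u hu]]; first by exists 0.
exists (u + t - u * t * s).
have -> : 1 - (u + t - u * t * s) * s = (1 - t * s) * (1 - u * s) by ring.
exact: ideal_mulM.
Qed.

End IdealFacts.

Section Localization.
Variables (A : comPzRingType) (P : maxIdeal A).
Local Notation S := (~` (P : set A)).

Local Notation fraction := (A * S)%type.

Lemma denP (s : S) : ~ (P : set A) (val s).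
Proof. by move: (valP s); rewrite in_setE. Qed.
Arguments denP : clear implicits.

Definition mkden (s : A) (hs : ~ (P : set A) s) : S := exist _ s (mem_set hs).

Definition den1 : S := mkden (@max_ideal_nP1 A P).
Definition denM (s t : S) : S := mkden (max_idealNM (denP s) (denP t)).

Definition fraction_eq (x y : fraction) : bool :=
  `[< exists2 u, ~ (P : set A) u & u * (x.1 * val y.2) = u * (y.1 * val x.2) >].

Lemma fraction_eq_refl : reflexive fraction_eq.
Proof. by move=> x; apply/asboolP; exists 1 => //; exact: max_ideal_nP1. Qed.

Lemma fraction_eq_sym : symmetric fraction_eq.
Proof. by move=> x y; apply/asboolP/asboolP=> -[u Pu e]; exists u. Qed.

Lemma fraction_eq_trans : transitive fraction_eq.
Proof.
move=> y x z /asboolP[u Pu xy] /asboolP[v Pv yz]; apply/asboolP.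
exists (u * v * val y.2).
  by apply: max_idealNM; [exact: max_idealNM|exact: denP].
transitivity (v * val z.2 * (u * (x.1 * val y.2))); first by ring.
rewrite xy; transitivity (u * val x.2 * (v * (y.1 * val z.2))); first by ring.
by rewrite yz; ring.
Qed.

Canonical fraction_equiv :=
  EquivRel fraction_eq fraction_eq_refl fraction_eq_sym fraction_eq_trans.

Definition localization : Type := {eq_quot fraction_eq}.
HB.instance Definition _ := Choice.on localization.
HB.instance Definition _ : EqQuotient fraction fraction_eq localization :=
  EqQuotient.on localization.

Definition mkfrac (a : A) (s : S) : localization := \pi_localization (a, s).

Lemma mkfracP a s b t : mkfrac a s = mkfrac b t <->
  exists2 u, ~ (P : set A) u & u * (a * val t) = u * (b * val s).
Proof.
split=> [/eqmodP/asboolP//|h]; by apply/eqmodP/asboolP.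
Qed.

Lemma mkfracE a s b t : a * val t = b * val s -> mkfrac a s = mkfrac b t.
Proof.
by move=> h; apply/mkfracP; exists 1; [exact: max_ideal_nP1|rewrite h].
Qed.

Lemma mkfrac_ex (f : localization) : exists a s, f = mkfrac a s.
Proof. by elim/quotW: f => -[a s]; exists a, s. Qed.

Definition loc0 : localization := mkfrac 0 den1.
Definition loc1 : localization := mkfrac 1 den1.
Definition loc_opp (f : localization) : localization :=
  mkfrac (- (repr f).1) (repr f).2.
Definition loc_add (f g : localization) : localization :=
  mkfrac ((repr f).1 * val (repr g).2 + (repr g).1 * val (repr f).2)
         (denM (repr f).2 (repr g).2).
Definition loc_mul (f g : localization) : localization :=
  mkfrac ((repr f).1 * (repr g).1) (denM (repr f).2 (repr g).2).

Lemma mkfrac_repr a s :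
  exists2 u, ~ (P : set A) u &
    u * ((repr (mkfrac a s)).1 * val s) = u * (a * val (repr (mkfrac a s)).2).
Proof.
apply/mkfracP; rewrite /mkfrac -[RHS](reprK (\pi_localization (a, s))).
by congr \pi_localization; case: (repr _).
Qed.

Lemma loc_oppE a s : loc_opp (mkfrac a s) = mkfrac (- a) s.
Proof.
apply/mkfracP; have [u Pu e] := mkfrac_repr a s; exists u => //.
by rewrite !mulNr !mulrN e.
Qed.

Lemma loc_addE a s b t :
  loc_add (mkfrac a s) (mkfrac b t) =
  mkfrac (a * val t + b * val s) (denM s t).
Proof.
apply/mkfracP; have [u Pu e] := mkfrac_repr a s.
have [v Pv f] := mkfrac_repr b t.
exists (u * v); first exact: max_idealNM.
set x := repr _ in e *; set y := repr _ in f *; rewrite /= in e f *.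
transitivity (v * sval y.2 * sval t * (u * (x.1 * sval s))
   + u * sval x.2 * sval s * (v * (y.1 * sval t))); first by ring.
by rewrite e f; ring.
Qed.

Lemma loc_mulE a s b t :
  loc_mul (mkfrac a s) (mkfrac b t) = mkfrac (a * b) (denM s t).
Proof.
apply/mkfracP; have [u Pu e] := mkfrac_repr a s.
have [v Pv f] := mkfrac_repr b t.
exists (u * v); first exact: max_idealNM.
set x := repr _ in e *; set y := repr _ in f *; rewrite /= in e f *.
transitivity ((u * (x.1 * sval s)) * (v * (y.1 * sval t))); first by ring.
by rewrite e f; ring.
Qed.

Lemma loc_addA : associative loc_add.
Proof.
move=> f g h; have [a [s ->]] := mkfrac_ex f; have [b [t ->]] := mkfrac_ex g.
have [c [u ->]] := mkfrac_ex h; rewrite !loc_addE; apply: mkfracE => /=; ring.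
Qed.
Lemma loc_addC : commutative loc_add.
Proof.
move=> f g; have [a [s ->]] := mkfrac_ex f; have [b [t ->]] := mkfrac_ex g.
rewrite !loc_addE; apply: mkfracE => /=; ring.
Qed.
Lemma loc_add0 : left_id loc0 loc_add.
Proof.
move=> f; have [a [s ->]] := mkfrac_ex f; rewrite loc_addE.
apply: mkfracE => /=; ring.
Qed.
Lemma loc_addN : left_inverse loc0 loc_opp loc_add.
Proof.
move=> f; have [a [s ->]] := mkfrac_ex f; rewrite loc_oppE loc_addE.
apply: mkfracE => /=; ring.
Qed.
Lemma loc_mulA : associative loc_mul.
Proof.
move=> f g h; have [a [s ->]] := mkfrac_ex f; have [b [t ->]] := mkfrac_ex g.
have [c [u ->]] := mkfrac_ex h; rewrite !loc_mulE; apply: mkfracE => /=; ring.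
Qed.
Lemma loc_mulC : commutative loc_mul.
Proof.
move=> f g; have [a [s ->]] := mkfrac_ex f; have [b [t ->]] := mkfrac_ex g.
rewrite !loc_mulE; apply: mkfracE => /=; ring.
Qed.
Lemma loc_mul1 : left_id loc1 loc_mul.
Proof.
move=> f; have [a [s ->]] := mkfrac_ex f; rewrite loc_mulE.
apply: mkfracE => /=; ring.
Qed.
Lemma loc_mulD : left_distributive loc_mul loc_add.
Proof.
move=> f g h; have [a [s ->]] := mkfrac_ex f; have [b [t ->]] := mkfrac_ex g.
have [c [u ->]] := mkfrac_ex h; rewrite !(loc_mulE, loc_addE).
apply: mkfracE => /=; ring.
Qed.

HB.instance Definition _ :=
  GRing.isZmodule.Build localization loc_addA loc_addC loc_add0 loc_addN.
HB.instance Definition _ :=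
  GRing.Zmodule_isComPzRing.Build localization loc_mulA loc_mulC loc_mul1 loc_mulD.

End Localization.
Arguments denP {A P} s _.

(* Cauchy sequences for the [I]-adic topology modulo null sequences. *)
Section Completion.
Variables (R : comPzRingType) (I : set R).

Definition cauchy (c : nat -> R) : Prop :=
  forall n, exists k, forall i j, (k <= i)%N -> (k <= j)%N ->
    ideal_pow I n (c i - c j).

Definition cauchy_pred : {pred nat -> R} := fun c => `[< cauchy c >].

Lemma cauchy_subring : subring_closed cauchy_pred.
Proof.
split=> [|c d /asboolP hc /asboolP hd|c d /asboolP hc /asboolP hd];
  apply/asboolP => n.
- by exists 0%N => i j _ _ /=; rewrite subrr; exact: (ideal0 (ideal_pow_ideal I n)).
- have [k hk] := hc n; have [l hl] := hd n; exists (maxn k l) => i j.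
  rewrite !geq_max => /andP[ki li] /andP[kj lj].
  have -> : (c - d) i - (c - d) j = (c i - c j) - (d i - d j).
    by rewrite !fctE; ring.
  by apply: (idealB (ideal_pow_ideal I n)); [exact: hk|exact: hl].
- have [k hk] := hc n; have [l hl] := hd n; exists (maxn k l) => i j.
  rewrite !geq_max => /andP[ki li] /andP[kj lj].
  have -> : (c * d) i - (c * d) j = d i * (c i - c j) + c j * (d i - d j).
    by rewrite !fctE; ring.
  by apply: (idealD (ideal_pow_ideal I n));
    apply: (idealMl _ (ideal_pow_ideal I n)); [exact: hk|exact: hl].
Qed.
HB.instance Definition _ :=
  GRing.isSubringClosed.Build (nat -> R) cauchy_pred cauchy_subring.

Definition cauchy_seq : Type := {c : nat -> R | c \in cauchy_pred}.
HB.instance Definition _ := SubChoice.on cauchy_seq.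
HB.instance Definition _ := 
  GRing.SubChoice_isSubComPzRing.Build (nat -> R) cauchy_pred cauchy_seq
    cauchy_subring.

Definition null_seq (c : cauchy_seq) : Prop :=
  forall n, exists k, forall i, (k <= i)%N -> ideal_pow I n (val c i).

Definition null_pred : {pred cauchy_seq} := fun c => `[< null_seq c >].

Lemma null_zmod : zmod_closed null_pred.
Proof.
split=> [|c d /asboolP hc /asboolP hd]; apply/asboolP => n.
  by exists 0%N => i _; exact: (ideal0 (ideal_pow_ideal I n)).
have [k hk] := hc n; have [l hl] := hd n; exists (maxn k l) => i.
rewrite geq_max => /andP[ki li].
by apply: (idealB (ideal_pow_ideal I n)); [exact: hk|exact: hl].
Qed.
HB.instance Definition _ := GRing.isZmodClosed.Build cauchy_seq null_pred null_zmod.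

Lemma nullMl c d : d \in null_pred -> c * d \in null_pred.
Proof.
move=> /asboolP hd; apply/asboolP => n; have [k hk] := hd n.
exists k => i ki; apply: (idealMl _ (ideal_pow_ideal I n)); exact: hk.
Qed.

Definition completion : Type := Quotient.quot null_pred.
HB.instance Definition _ := GRing.Zmodule.on completion.
HB.instance Definition _ :=
  EqQuotient.copy completion (Quotient.quot null_pred).

Definition completion_one : completion := \pi_completion 1.
Definition completion_mul (x y : completion) : completion :=
  \pi_completion (repr x * repr y).

Lemma completion_piP (c d : cauchy_seq) :
  (\pi_completion c = \pi_completion d) <-> (c - d \in null_pred).
Proof. by rewrite (Quotient.idealrBE null_pred); split=> /eqP. Qed.

Lemma completion_piD (c d : cauchy_seq) :
  \pi_completion (c + d) = \pi_completion c + \pi_completion d.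
Proof. by rewrite !piE. Qed.

Lemma completion_mulE c d :
  completion_mul (\pi c) (\pi d) = \pi_completion (c * d).
Proof.
apply/completion_piP; set c' := repr _; set d' := repr _.
have hc : c' - c \in null_pred by apply/completion_piP; rewrite reprK.
have hd : d' - d \in null_pred by apply/completion_piP; rewrite reprK.
have -> : c' * d' - c * d = d' * (c' - c) + c * (d' - d) by ring.
by rewrite rpredD // nullMl.
Qed.

Lemma completion_mulA : associative completion_mul.
Proof.
by move=> x y z; rewrite -[x]reprK -[y]reprK -[z]reprK !completion_mulE mulrA.
Qed.
Lemma completion_mulC : commutative completion_mul.
Proof.
by move=> x y; rewrite -[x]reprK -[y]reprK !completion_mulE mulrC.
Qed.
Lemma completion_mul1 : left_id completion_one completion_mul.
Proof. by move=> x; rewrite -[x]reprK completion_mulE mul1r. Qed.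
Lemma completion_mulD : left_distributive completion_mul +%R.
Proof.
move=> x y z; rewrite -[x]reprK -[y]reprK -[z]reprK.
rewrite -completion_piD !completion_mulE mulrDl completion_piD; reflexivity.
Qed.

HB.instance Definition _ := GRing.Zmodule_isComPzRing.Build completion
  completion_mulA completion_mulC completion_mul1 completion_mulD.

End Completion.
Arguments null_pred {R} I _.

(* A module all of whose elements are killed by powers of [I] is a module over
   the [I]-adic completion: the product of the class of [c] with [x] is the
   eventual value of the sequence [c k *: x]. *)
Section CompletionScale.
Variables (R : comPzRingType) (I : set R) (V : lmodType R).

Definition eventual_scale (c : nat -> R) (x y : V) : Prop :=
  exists k, forall i, (k <= i)%N -> c i *: x = y.

Definition completion_scale (c : completion I) (x : V) : V :=
  xget 0 (eventual_scale (val (repr c)) x).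

Hypothesis tors : forall x : V, exists n, forall a, ideal_pow I n a -> a *: x = 0.

Lemma eventual_scale_ex (c : cauchy_seq I) x :
  exists y, eventual_scale (val c) x y.
Proof.
have [n hn] := tors x; have /asboolP/(_ n)[k hk] := valP c.
exists (val c k *: x), k => i ki; apply/eqP; rewrite -subr_eq0 -scalerBl.
by apply/eqP/hn/hk.
Qed.

Lemma eventual_scale_uniq c x y z :
  eventual_scale c x y -> eventual_scale c x z -> y = z.
Proof.
move=> [k hk] [l hl].
by rewrite -(hk (maxn k l)) ?leq_maxl// (hl (maxn k l)) ?leq_maxr.
Qed.

Lemma completion_scaleE (c : cauchy_seq I) x y :
  eventual_scale (val c) x y -> completion_scale (\pi_(completion I) c) x = y.
Proof.
move=> hy; rewrite /completion_scale; set d := repr _.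
have hd : d - c \in null_pred I by apply/completion_piP; rewrite reprK.
have [n hn] := tors x; have /asboolP/(_ n)[k hk] := hd; have [l hl] := hy.
have ey : eventual_scale (val d) x y.
  exists (maxn k l) => i; rewrite geq_max => /andP[ki li].
  rewrite -(hl _ li); apply/eqP; rewrite -subr_eq0 -scalerBl.
  exact/eqP/hn/hk.
by apply: xget_subset1 => // u v; exact: eventual_scale_uniq.
Qed.

Lemma completion_scaleP (c : cauchy_seq I) x :
  eventual_scale (val c) x (completion_scale (\pi_(completion I) c) x).
Proof. by have [y hy] := eventual_scale_ex c x; rewrite (completion_scaleE hy). Qed.

Lemma completion_scaleA a b x :
  completion_scale a (completion_scale b x) = completion_scale (a * b) x.
Proof.
rewrite -[a]reprK -[b]reprK; set c := repr a; set d := repr b.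
rewrite [in RHS]/GRing.mul /= completion_mulE; apply/esym/completion_scaleE.
have [k hk] := completion_scaleP d x.
have [l hl] := completion_scaleP c (completion_scale (\pi_(completion I) d) x).
exists (maxn k l) => i; rewrite geq_max => /andP[ki li].
by rewrite -[RHS](hl i li) -(hk i ki) scalerA.
Qed.

Lemma completion_scale1 : left_id 1 completion_scale.
Proof. by move=> x; apply: completion_scaleE; exists 0%N => i _; exact: scale1r. Qed.

Lemma completion_scaleDr : right_distributive completion_scale +%R.
Proof.
move=> a x y; rewrite -[a]reprK; set c := repr a; apply: completion_scaleE.
have [k hk] := completion_scaleP c x; have [l hl] := completion_scaleP c y.
exists (maxn k l) => i; rewrite geq_max => /andP[ki li].
by rewrite scalerDr (hk i ki) (hl i li).
Qed.

Lemma completion_scaleDl x :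
  {morph completion_scale^~ x : a b / a + b}.
Proof.
move=> a b; rewrite -[a]reprK -[b]reprK; set c := repr a; set d := repr b.
rewrite -completion_piD; apply: completion_scaleE.
have [k hk] := completion_scaleP c x; have [l hl] := completion_scaleP d x.
exists (maxn k l) => i; rewrite geq_max => /andP[ki li].
by rewrite -(hk i ki) -(hl i li) -scalerDl.
Qed.

End CompletionScale.

(* When [R] is local, this is its maximal ideal. *)
Definition nonunits (R : comPzRingType) : set R :=
  [set x | ~ exists y, y * x = 1].

Definition completed_localization (A : comPzRingType) (P : maxIdeal A) :
    comPzRingType :=
  completion (@nonunits (localization P)).

Section Component.
Variables (A : comPzRingType) (P : maxIdeal A) (Q : lmodType A).
Local Notation S := (~` (P : set A)).

(* The elements killed by a power of [P]. When [Q] is artinian (and [A]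
   noetherian), this is the summand of [Q] having [P] as only associated prime
   in the canonical decomposition of [Q]; it is identified with the localization
   of [Q] at [P]. *)
Definition component_pred : {pred Q} :=
  fun x => `[< exists n, forall a, ideal_pow P n a -> a *: x = 0 >].

Lemma component_submod : submod_closed component_pred.
Proof.
split; first by apply/asboolP; exists 0%N => a _; rewrite scaler0.
move=> b x y /asboolP[n hn] /asboolP[m hm]; apply/asboolP.
exists (maxn n m) => a ha; rewrite scalerDr scalerA mulrC -scalerA.
rewrite hn ?hm ?scaler0 ?addr0//.
  by apply: ideal_pow_le ha; exact: leq_maxr.
by apply: ideal_pow_le ha; exact: leq_maxl.
Qed.
HB.instance Definition _ :=
  GRing.isSubmodClosed.Build A Q component_pred component_submod.

Definition component : Type := {x : Q | x \in component_pred}.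
HB.instance Definition _ := SubChoice.on component.
HB.instance Definition _ := [SubChoice_isSubLmodule of component by <:].

Lemma component_tors (x : component) :
  exists n, forall a, ideal_pow P n a -> a *: x = 0.
Proof.
have /asboolP[n hn] := valP x; exists n => a ha.
by apply: val_inj; rewrite linearZ /= hn.
Qed.

Lemma component_div (s : S) (x : component) : exists y, val s *: y = x.
Proof.
have [n hn] := component_tors x.
have [t /hn/eqP] := max_ideal_pow_inv n (denP s).
rewrite scalerBl scale1r subr_eq0 => /eqP e.
by exists (t *: x); rewrite scalerA mulrC -e.
Qed.

Lemma component_inj (s : A) (x y : component) :
  ~ (P : set A) s -> s *: x = s *: y -> x = y.
Proof.
move=> hs e; apply/eqP; rewrite -subr_eq0; apply/eqP.
have [n hn] := component_tors (x - y).
have [t /hn/eqP] := max_ideal_pow_inv n hs.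
rewrite scalerBl scale1r subr_eq0 => /eqP ->.
by rewrite -scalerA scalerBr e subrr scaler0.
Qed.

(* Multiplication by an element outside of [P] is bijective on [component], so
   that [component] is a module over the localization. *)
Definition loc_component : Type := component.
HB.instance Definition _ := GRing.Zmodule.on loc_component.

Definition loc_scale (f : localization P) (x : loc_component) : loc_component :=
  xget 0 [set y : component | val (repr f).2 *: y = (repr f).1 *: (x : component)].

Lemma loc_scaleE a s (x y : component) :
  val s *: y = a *: x -> loc_scale (mkfrac a s) x = y.
Proof.
move=> h; have [u Pu e] := mkfrac_repr a s.
rewrite /loc_scale; move: e; set r := repr _ => e.
apply: xget_subset1 => [|z t /= hz ht].
  apply: (@component_inj (u * sval s)).
    by apply: max_idealNM => //; exact: denP.
  rewrite /= in h e *; transitivity ((u * sval r.2) *: (sval s *: y)).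
    by rewrite !scalerA; congr (_ *: _); ring.
  rewrite h !scalerA; congr (_ *: _).
  by transitivity (u * (a * sval r.2)); [ring|rewrite -e; ring].
by apply: component_inj (denP r.2) _; rewrite hz ht.
Qed.

Lemma loc_scaleP a s (x : component) :
  val s *: (loc_scale (mkfrac a s) x : component) = a *: x.
Proof.
have [y hy] := component_div s (a *: x).
by rewrite (loc_scaleE hy).
Qed.

Lemma loc_scaleA f g x : loc_scale f (loc_scale g x) = loc_scale (f * g) x.
Proof.
have [a [s ->]] := mkfrac_ex f; have [b [t ->]] := mkfrac_ex g.
rewrite [in RHS]/GRing.mul /= loc_mulE; apply/esym/loc_scaleE.
by rewrite [val (denM s t)]mulrC -scalerA loc_scaleP scalerA mulrC -scalerA
   loc_scaleP scalerA.
Qed.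

Lemma loc_scale1 : left_id 1 loc_scale.
Proof. by move=> x; apply: loc_scaleE. Qed.

Lemma loc_scaleDr : right_distributive loc_scale +%R.
Proof.
move=> f x y; have [a [s ->]] := mkfrac_ex f; apply: loc_scaleE.
by rewrite scalerDr !loc_scaleP -scalerDr.
Qed.

Lemma loc_scaleDl x : {morph loc_scale^~ x : f g / f + g}.
Proof.
move=> f g; have [a [s ->]] := mkfrac_ex f; have [b [t ->]] := mkfrac_ex g.
rewrite [in LHS]/GRing.add /= loc_addE; apply: loc_scaleE => /=.
have /= hf := loc_scaleP a s x; have /= hg := loc_scaleP b t x.
rewrite scalerDr [RHS]scalerDl; congr (_ + _).
  by rewrite [sval s * _]mulrC -scalerA hf scalerA mulrC.
by rewrite -scalerA hg scalerA mulrC.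
Qed.

HB.instance Definition _ := GRing.Zmodule_isLmodule.Build (localization P)
  loc_component loc_scaleA loc_scale1 loc_scaleDr loc_scaleDl.

Lemma nonunits_loc a s : nonunits (mkfrac a s : localization P) -> (P : set A) a.
Proof.
move=> h; apply: contrapT => Pa; apply: h; exists (mkfrac (val s) (mkden Pa)).
rewrite /GRing.mul /= loc_mulE; apply: mkfracE => /=; ring.
Qed.

Lemma ideal_pow_loc n f : ideal_pow (@nonunits (localization P)) n f ->
  exists a s, ideal_pow P n a /\ f = mkfrac a s.
Proof.
elim: n f => [|n IHn] f.
  by move=> _; have [a [s ->]] := mkfrac_ex f; exists a, s.
have Pi := ideal_pow_ideal P n.+1.
apply: (smallest_sub (X := [set f | exists a s,
  ideal_pow P n.+1 a /\ f = mkfrac a s])) => {f}.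
  split.
  - by exists 0, (den1 P); split => //; exact: ideal0.
  - move=> f g [a [s [ha ->]]] [b [t [hb ->]]].
    rewrite /GRing.add /= loc_addE; eexists _, _; split; last by [].
    rewrite ![_ * val _]mulrC.
    by apply: (idealD Pi); apply: (idealMl _ Pi).
  - move=> f g [b [t [hb ->]]]; have [a [s ->]] := mkfrac_ex f.
    rewrite /GRing.scale /= /GRing.mul /= loc_mulE.
    by eexists _, _; split; last by []; exact: (idealMl _ Pi).
move=> _ [f hf [g /IHn[b [t [hb ->]]] <-]].
have [a [s e]] := mkfrac_ex f; rewrite e in hf *.
rewrite /GRing.mul /= loc_mulE; eexists _, _; split; last by [].
exact: ideal_mulM (nonunits_loc hf) hb.
Qed.

Lemma loc_component_tors (x : loc_component) :
  exists n, forall f, ideal_pow (@nonunits (localization P)) n f -> f *: x = 0.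
Proof.
have [n hn] := component_tors x; exists n => _ /ideal_pow_loc[a [s [ha ->]]].
by apply: loc_scaleE; rewrite scaler0 hn.
Qed.

Definition completed_component : Type := loc_component.
HB.instance Definition _ := GRing.Zmodule.on completed_component.
HB.instance Definition _ := GRing.Zmodule_isLmodule.Build
  (completed_localization P) completed_component
  (completion_scaleA loc_component_tors) (completion_scale1 loc_component_tors)
  (completion_scaleDr loc_component_tors) (completion_scaleDl loc_component_tors).

End Component.

Section Dual.
Variables (R : comPzRingType) (V E : lmodType R).

Definition linear_pred : {pred V -> E} := fun f => `[< linear f >].

Lemma linear_submod : submod_closed linear_pred.
Proof.
split; first by apply/asboolP => a x y; rewrite [RHS]addr0 scaler0.
move=> b f g /asboolP hf /asboolP hg; apply/asboolP => a x y.
have E0 z : (b *: f + g) z = b *: f z + g z by [].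
rewrite !E0 hf hg !scalerDr !scalerA [b * a]mulrC; exact: addrACA.
Qed.
HB.instance Definition _ :=
  GRing.isSubmodClosed.Build R (V -> E) linear_pred linear_submod.

Definition hom : Type := {f : V -> E | f \in linear_pred}.
HB.instance Definition _ := SubChoice.on hom.
HB.instance Definition _ := [SubChoice_isSubLmodule of hom by <:].

End Dual.

Definition injective_module (R : comPzRingType) (E : lmodType R) : Prop :=
  forall (U V : lmodType R) (i : {linear U -> V}) (f : {linear U -> E}),
    injective i -> exists g : {linear V -> E}, forall u, g (i u) = f u.

Definition injective_hull (R : comPzRingType) (K E : lmodType R) : Prop :=
  injective_module E /\ exists2 j : {linear K -> E}, injective j &
    forall N : set E, is_submodule N -> (exists2 x, N x & x != 0) ->
      exists2 x, (N `&` range j) x & x != 0.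

(* For local [R]: [K], as an [R]-module, is the quotient of [R] by its maximal
   ideal. *)
Definition is_residue_field (R : comPzRingType) (K : lmodType R) : Prop :=
  exists2 p : {linear R^o -> K}, (forall y, exists x, p x = y) &
    forall x, p x = 0 <-> nonunits x.

Definition residue_hull (R : comPzRingType) (E : lmodType R) : Prop :=
  exists2 K : lmodType R, is_residue_field K & injective_hull K E.

(* Suprema are taken in [\bar int]; the supremum of the empty set is -oo. *)

Definition prime_chain (R : comPzRingType) (I : set R) (n : nat) : Prop :=
  exists p : nat -> set R,
    (forall i, (i <= n)%N -> prime_ideal (p i) /\ I `<=` p i) /\
    (forall i, (i < n)%N -> p i `<` p i.+1).

(* The Krull dimension of the ring [R / annihilator M], whose prime ideals
   correspond to those of [R] containing [annihilator M]. *)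
Definition krull_dim (R : comPzRingType) (M : lmodType R) : \bar int :=
  supremum -oo%E [set (Posz n)%:E | n in prime_chain (annihilator M)].

(* Associated primes of an artinian module are maximal, so that [P] ranges over
   all of them. The module [hom (completed_component P Q) E] is the Matlis dual
   over the complete local ring [completed_localization P]; up to isomorphism it
   does not depend on the injective hull [E]. *)
Definition artinian_loewy_dim (A : comPzRingType) (Q : lmodType A) : \bar int :=
  supremum -oo%E [set d | exists P : maxIdeal A, associated_prime Q P /\
    exists2 E : lmodType (completed_localization P), residue_hull E &
      d = krull_dim (hom (completed_component P Q) E)].

Definition loewy_dim (A : comPzRingType) (M : lmodType A) : \bar int :=
  supremum -oo%E [set d | exists (Q : lmodType A) (f : {linear M -> Q}),
    [/\ forall y, exists x, f x = y, artinian Q & d = artinian_loewy_dim Q]].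

(* Main.v *)
(* Matlis duality enters only through [Ann (Hom (V, E)) = Ann V], so that the
   claim reads, for the [P]-primary component [V] of an artinian module and the
   complete local ring [R]: [V] has a chain of submodules of type [omega^2] if
   and only if [R] has a chain of three primes above [Ann V].

   From primes [p0 < p1 < p2], take [N] minimal among the submodules of [V] with
   [Ann N <= p0] and [x] in [p1] outside of [p0]; then [x N = N].  If
   [W = (0 :_N x)] is not noetherian, the preimages under the powers of [x] of an
   infinite chain in [W] form a chain of type [omega^2].  If it is noetherian,
   [End N / x End N] is finitely generated and completeness makes [End N] a
   finitely generated [R]-module.  If [s] kills [W], then [s] factors through [x]
   on [N], and the determinant trick puts a power of [s] in [x R + Ann N <= p1];
   taking for [s] a power of an element of [p2] gives a contradiction.

   Conversely, call a submodule tame when all but finitely many of the omega-blocks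
   of any chain indexed by [omega^2] in it are stationary.  Submodules that are
   minimal among the non-tame, or among the non-noetherian, ones are secondary,
   hence have an attached prime.  If a non-tame submodule exists, a minimal one
   [N], a minimal non-noetherian submodule [W] of [(0 :_N y)] for a suitable [y]
   in [P] with [y N = N], and a socle element of [W] provide three primes. *)
Require Import Defs.
From HB Require Import structures.
From mathcomp Require Import all_boot all_order all_algebra.
From mathcomp Require Import all_classical constructive_ereal.
From mathcomp Require Import generic_quotient ring_quotient ring.
Set Implicit Arguments.
Unset Strict Implicit.
Unset Printing Implicit Defensive.
Import Order.TTheory GRing.Theory Num.Theory.
Local Open Scope classical_set_scope.
Local Open Scope ring_scope.
Local Open Scope quotient_scope.
Local Notation hom := Defs.hom.

(** * Submodules and chain conditions *)

Lemma dependent_choice (T : Type) (P : T -> Prop) (r : T -> T -> Prop)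
    (t0 : T) :
  P t0 -> (forall t, P t -> exists2 u, P u & r t u) ->
  exists2 f : nat -> T, forall n, P (f n) & forall n, r (f n) (f n.+1).
Proof.
move=> Pt0 step.
have /choice[g hg] : forall t : {t | P t}, exists u : {t | P t}, r (sval t) (sval u).
  by move=> [t Pt]; have [u Pu tu] := step t Pt; exists (exist _ u Pu).
exists (fun n => sval (iter n g (exist _ t0 Pt0))) => n; first exact: svalP.
exact: hg.
Qed.

Section Submodules.
Variables (R : comPzRingType) (V : lmodType R).
Implicit Types (N K : set V) (r s : R).

Lemma submod0 N : is_submodule N -> N 0. Proof. by case. Qed.
Lemma submodD N x y : is_submodule N -> N x -> N y -> N (x + y).
Proof. by case=> _ h _; apply: h. Qed.
Lemma submodZ N r x : is_submodule N -> N x -> N (r *: x).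
Proof. by case=> _ _; apply. Qed.
Lemma submodN N x : is_submodule N -> N x -> N (- x).
Proof. by move=> hN Nx; rewrite -scaleN1r; exact: submodZ. Qed.
Lemma submodB N x y : is_submodule N -> N x -> N y -> N (x - y).
Proof. by move=> hN Nx Ny; apply: submodD => //; exact: submodN. Qed.
Lemma submod_addKr N x y : is_submodule N -> N y -> N (x + y) -> N x.
Proof. by move=> hN Ny Nxy; rewrite -(addrK y x); exact: submodB. Qed.
Lemma submod_sum N (I : Type) (s : seq I) (P : pred I) (F : I -> V) :
  is_submodule N -> (forall i, P i -> N (F i)) -> N (\sum_(i <- s | P i) F i).
Proof.
move=> hN hF; elim/big_ind: _ => //; first exact: submod0.
by move=> x y; exact: submodD.
Qed.

Definition cyclic_set (v : V) : set V := [set w | exists r : R, w = r *: v].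
Definition scale_set r N : set V := [set r *: v | v in N].
Definition kernel_set r N : set V := N `&` [set v | r *: v = 0].
Definition add_set N K : set V := [set u + v | u in N & v in K].

Lemma submod_zero : is_submodule [set 0 : V].
Proof.
split=> //= [x y -> ->|r x ->]; [exact: addr0|exact: scaler0].
Qed.

Lemma submodT : is_submodule [set: V]. Proof. by split. Qed.

Lemma submod_cyclic (v : V) : is_submodule (cyclic_set v).
Proof.
split; first by exists 0; rewrite scale0r.
  by move=> _ _ [r ->] [s ->]; exists (r + s); rewrite scalerDl.
by move=> s _ [r ->]; exists (s * r); rewrite scalerA.
Qed.

Lemma submodI N K : is_submodule N -> is_submodule K -> is_submodule (N `&` K).
Proof.
move=> hN hK; split; first by split; exact: submod0.
  by move=> x y [? ?] [? ?]; split; exact: submodD.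
by move=> r x [? ?]; split; exact: submodZ.
Qed.

Lemma submod_ann r : is_submodule [set v : V | r *: v = 0].
Proof.
split=> [|x y /= hx hy|s x /= hx]; first exact: scaler0.
  by rewrite scalerDr hx hy addr0.
by rewrite scalerA mulrC -scalerA hx scaler0.
Qed.

Lemma submod_kernel r N : is_submodule N -> is_submodule (kernel_set r N).
Proof. by move=> hN; apply: submodI => //; exact: submod_ann. Qed.

Lemma submod_preim r N : is_submodule N -> is_submodule [set v : V | N (r *: v)].
Proof.
move=> hN; split=> [|x y hx hy|s x hx] /=.
- by rewrite scaler0; exact: submod0.
- by rewrite scalerDr; exact: submodD.
- by rewrite scalerA mulrC -scalerA; exact: submodZ.
Qed.

Lemma submod_scale r N : is_submodule N -> is_submodule (scale_set r N).
Proof.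
move=> hN; split=> [|_ _ [x Nx <-] [y Ny <-]|s _ [x Nx <-]].
- by exists 0; [exact: submod0|rewrite scaler0].
- by exists (x + y); [exact: submodD|rewrite scalerDr].
- by exists (s *: x); [exact: submodZ|rewrite !scalerA mulrC].
Qed.

Lemma submod_add N K :
  is_submodule N -> is_submodule K -> is_submodule (add_set N K).
Proof.
move=> hN hK; split.
- by exists 0; [exact: submod0|exists 0; [exact: submod0|rewrite addr0]].
- move=> _ _ [x Nx [y Ky <-]] [z Nz [t Kt <-]].
  exists (x + z); first exact: submodD.
  by exists (y + t); [exact: submodD|rewrite addrACA].
- move=> r _ [x Nx [y Ky <-]]; exists (r *: x); first exact: submodZ.
  by exists (r *: y); [exact: submodZ|rewrite scalerDr].
Qed.

Lemma scale_set_sub r N : is_submodule N -> scale_set r N `<=` N.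
Proof. by move=> hN _ [x Nx <-]; exact: submodZ. Qed.

Lemma scale_setS r N K : N `<=` K -> scale_set r N `<=` scale_set r K.
Proof. by move=> NK _ [x Nx <-]; exists x => //; exact: NK. Qed.

Lemma scale_setM r s N : scale_set (r * s) N = scale_set r (scale_set s N).
Proof.
apply/seteqP; split=> [_ [x Nx <-]|_ [_ [x Nx <-] <-]].
  by exists (s *: x); [exists x|rewrite scalerA].
by exists x; rewrite ?scalerA.
Qed.

Lemma add_setl N K : is_submodule K -> N `<=` add_set N K.
Proof. by move=> hK x Nx; exists x => //; exists 0; [exact: submod0|rewrite addr0]. Qed.

Lemma add_setr N K : is_submodule N -> K `<=` add_set N K.
Proof.
move=> hN x Nx; exists 0; first exact: submod0.
by exists x; rewrite ?add0r.
Qed.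

Lemma add_setS N N' K : N `<=` N' -> add_set N K `<=` add_set N' K.
Proof. by move=> NN' _ [x Nx [y Ky <-]]; exists x; [exact: NN'|exists y]. Qed.

Lemma chain_le (c : nat -> set V) : (forall n, c n `<=` c n.+1) ->
  forall m n, (m <= n)%N -> c m `<=` c n.
Proof.
move=> h m; elim=> [|n IHn]; first by rewrite leqn0 => /eqP->.
rewrite leq_eqVlt => /orP[/eqP->//|/IHn mn]; exact: subset_trans (h n).
Qed.

Definition stationary (c : nat -> set V) : Prop :=
  exists n, forall m, (n <= m)%N -> c m = c n.

Lemma stationary_strict (c : nat -> set V) :
  stationary c -> ~ (forall n, ~ (c n.+1 `<=` c n)).
Proof. by move=> [n hn] /(_ n); apply; rewrite hn. Qed.

(* Modular law: a submodule [c] of [N + K] is determined, within larger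
   submodules, by [c & N] and [(c + N) & K]. *)
Lemma stationary_add N K (c : nat -> set V) :
  is_submodule N -> (forall n, is_submodule (c n)) ->
  (forall n, c n `<=` add_set N K) -> (forall n, c n `<=` c n.+1) ->
  stationary (fun n => c n `&` N) ->
  stationary (fun n => add_set (c n) N `&` K) -> stationary c.
Proof.
move=> hN hc cNK cS [n hn] [m hm]; exists (maxn n m) => k; rewrite geq_max.
move=> /andP[nk mk]; apply/seteqP; split; last first.
  by apply: chain_le cS _ _ _; rewrite geq_max nk.
move=> v ckv; have [a Na [b Kb eab]] := cNK _ _ ckv.
(* The [K]-part [b = v - a] of [v] lies in [c k + N]; stationarity there yields [u] in the smaller
   term with [v - u] in [N]. *)
have : (add_set (c k) N `&` K) b.
  split=> //; exists v => //; exists (- a); first exact: submodN.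
  by rewrite -eab [a + b]addrC addrK.
rewrite hm // -(hm (maxn n m)) ?leq_maxr// => -[[u cu [a' Na' ub]] _].
have cku : c k u by apply: chain_le cS _ _ _ _ cu; rewrite geq_max nk.
have : (c k `&` N) (v - u).
  split; first exact: submodB.
  by rewrite -eab -ub addrCA [u + _]addrC addrK; exact: submodD.
rewrite hn // -(hn (maxn n m)) ?leq_maxl// => -[h _].
by rewrite -(subrK u v); exact: submodD.
Qed.

(** A term is determined, within larger ones, by its kernel and image under [r]: an element of the
    larger term differs by a kernel element from one of the smaller term with the same image. *)
Lemma stationary_ext r (c : nat -> set V) :
  (forall n, is_submodule (c n)) -> (forall n, c n `<=` c n.+1) ->
  stationary (fun n => kernel_set r (c n)) ->
  stationary (fun n => scale_set r (c n)) -> stationary c.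
Proof.
move=> hc cS [n hn] [m hm]; exists (maxn n m) => k; rewrite geq_max.
move=> /andP[nk mk]; apply/seteqP; split; last first.
  by apply: chain_le cS _ _ _; rewrite geq_max nk.
move=> v ckv; have : scale_set r (c k) (r *: v) by exists v.
rewrite hm // -(hm (maxn n m)) ?leq_maxr// => -[u cu e].
have cku : c k u by apply: chain_le cS _ _ _ _ cu; rewrite geq_max nk.
have : kernel_set r (c k) (v - u).
  by split; [exact: submodB|rewrite /= scalerBr e subrr].
rewrite hn // -(hn (maxn n m)) ?leq_maxl// => -[h _].
by rewrite -(subrK u v); exact: submodD.
Qed.

Definition acc N : Prop := forall c : nat -> set V,
  (forall n, is_submodule (c n)) -> (forall n, c n `<=` N) ->
  (forall n, c n `<=` c n.+1) -> stationary c.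

(* The indices [(i, j)] of [c] stand for the ordinals [omega * i + j]. *)
Definition tame N : Prop := forall c : nat -> nat -> set V,
  (forall i j, is_submodule (c i j)) -> (forall i j, c i j `<=` N) ->
  (forall i j, c i j `<=` c i j.+1) -> (forall i j, c i j `<=` c i.+1 0) ->
  exists i0, forall i, (i0 <= i)%N -> stationary (c i).

(** What [acc] and [tame] have in common; the theory of minimal submodules outside of a class is
    derived from it once for both. *)
Definition additive_class (C : set V -> Prop) : Prop :=
  [/\ C [set 0], forall N K, N `<=` K -> C K -> C N &
    forall N K, is_submodule N -> is_submodule K -> C N -> C K ->
      C (add_set N K)].

Lemma acc_tame N : acc N -> tame N.
Proof.
by move=> aN c hc cN cS _; exists 0%N => i _; apply: aN.
Qed.

Lemma acc_zero : acc [set 0].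
Proof.
move=> c hc c0 _; exists 0%N => m _; apply/seteqP.
by split=> v /c0 ->; exact: submod0.
Qed.

Lemma acc_additive : additive_class acc.
Proof.
split; first exact: acc_zero.
- by move=> N K NK aK c hc cN; apply: aK => // n; exact: subset_trans NK.
- move=> N K hN hK aN aK c hc cNK cS; apply: (stationary_add hN hc cNK cS).
    by apply: aN => n; [exact: submodI|move=> ? []|exact: setSI].
  apply: aK => n; [|by move=> ? []|by apply: setSI; exact: add_setS].
  by apply: submodI => //; exact: submod_add.
Qed.

Lemma tame_additive : additive_class tame.
Proof.
split; first by apply: acc_tame; exact: acc_zero.
- by move=> N K NK tK c hc cN; apply: tK => // i j; exact: subset_trans NK.
- move=> N K hN hK tN tK c hc cNK cS cT.
  have [|||| n hn] := tN (fun i j => c i j `&` N).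
  + by move=> i j; exact: submodI.
  + by move=> i j ? [].
  + by move=> i j; exact: setSI.
  + by move=> i j; exact: setSI.
  have [|||| m hm] := tK (fun i j => add_set (c i j) N `&` K).
  + by move=> i j; apply: submodI => //; exact: submod_add.
  + by move=> i j ? [].
  + by move=> i j; apply: setSI; exact: add_setS.
  + by move=> i j; apply: setSI; exact: add_setS.
  exists (maxn n m) => i; rewrite geq_max => /andP[ni mi].
  by apply: (stationary_add hN) (hn i ni) (hm i mi).
Qed.

Lemma acc_ext r N : is_submodule N -> acc (kernel_set r N) ->
  acc (scale_set r N) -> acc N.
Proof.
move=> hN aK aI c hc cN cS; apply: (stationary_ext (r := r)) => //.
- apply: aK => n; first exact: submod_kernel.
    exact: setSI.
  exact: setSI.
- apply: aI => n; first exact: submod_scale.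
    exact: scale_setS.
  exact: scale_setS.
Qed.

(** Induction on [n]: [r] maps the kernel of [r ^+ n.+1] into that of [r ^+ n], and what it kills
    there is noetherian by assumption. *)
Lemma acc_kernelX r N n : is_submodule N -> acc (kernel_set r N) ->
  acc (kernel_set (r ^+ n) N).
Proof.
move=> hN aK; elim: n => [|n IHn].
  by have [_ sub _] := acc_additive; apply: sub acc_zero => x [_ /=]; rewrite scale1r.
have [_ sub _] := acc_additive.
apply: (@acc_ext r); first exact: submod_kernel.
  by apply: sub aK => x [[Nx _] /= rx]; split.
apply: sub IHn => _ [x [Nx /= rx] <-]; split; first exact: submodZ.
by rewrite /= scalerA -exprSr.
Qed.

Lemma not_acc_strict N : ~ acc N -> exists c : nat -> set V,
  [/\ forall n, is_submodule (c n), forall n, c n `<=` N &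
      forall n, c n `<` c n.+1].
Proof.
move=> naN.
have [c [hc cN cS nst]] : exists c : nat -> set V,
    [/\ forall n, is_submodule (c n), forall n, c n `<=` N,
        forall n, c n `<=` c n.+1 & ~ stationary c].
  apply: contrapT => h; apply: naN => c hc cN cS; apply: contrapT => nst.
  by apply: h; exists c.
(* Dependent choice on the indices thins out the chain to a strict one. *)
have [n|f _ hf] := @dependent_choice nat (fun=> True) (fun n m => c n `<` c m) 0%N I.
  move=> _; apply: contrapT => h; apply: nst; exists n => m nm.
  apply/seteqP; split; last exact: chain_le.
  apply: contrapT => cmn; apply: h; exists m => //; split=> //.
  exact: chain_le.
by exists (fun n => c (f n)).
Qed.

Lemma acc_max N (F : set V -> Prop) K0 : acc N ->
  (forall K, F K -> is_submodule K /\ K `<=` N) -> F K0 ->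
  exists2 K, F K & forall K', F K' -> K `<=` K' -> K' `<=` K.
Proof.
move=> aN hF FK0; apply: contrapT => h.
have [|c Fc cS] := @dependent_choice _ F proper K0 FK0.
  move=> K FK; apply: contrapT => h'; apply: h; exists K => // K' FK' KK'.
  by apply: contrapT => nKK'; apply: h'; exists K'.
have [|||n /(_ n.+1 (leqnSn n)) e] := aN c.
- by move=> n; have [] := hF _ (Fc n).
- by move=> n; have [] := hF _ (Fc n).
- by move=> n; exact: properW.
by have := cS n; rewrite e => /properxx.
Qed.

Lemma artinian_min (F : set V -> Prop) K0 : artinian V ->
  (forall K, F K -> is_submodule K) -> F K0 ->
  exists K, [/\ F K, K `<=` K0 & forall K', F K' -> K' `<=` K -> K' = K].
Proof.
move=> aV hF FK0; apply: contrapT => h.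
have [||c Fc cS] := @dependent_choice _ (fun K => F K /\ K `<=` K0)
  (fun K K' => K' `<` K) K0.
- by split.
- move=> K [FK KK0]; apply: contrapT => h'; apply: h; exists K; split=> //.
  move=> K' FK' KK'; apply: contrapT => nKK'; apply: h'; exists K'.
    by split=> //; exact: subset_trans KK0.
  by split=> // KK'2; apply: nKK'; apply/seteqP.
have [||n /(_ n.+1 (leqnSn n)) e] := aV c.
- by move=> n; apply: hF; have [] := Fc n.
- by move=> n; exact: properW.
by have := cS n; rewrite e => /properxx.
Qed.

Lemma artinian_scaleX r N : artinian V -> is_submodule N ->
  exists n, forall m, (n <= m)%N ->
    scale_set (r ^+ m) N = scale_set (r ^+ n) N.
Proof.
move=> aV hN; apply: (aV (fun n => scale_set (r ^+ n) N)) => n.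
  exact: submod_scale.
by rewrite exprSr scale_setM; apply: scale_setS; exact: scale_set_sub.
Qed.

(** The covering half of Fitting's lemma. The sum is not direct in general, as multiplication by a
    prime [p] on the [p]-primary part of Q / Z shows. *)
Lemma fitting r N n : is_submodule N ->
  scale_set (r ^+ (n + n)) N = scale_set (r ^+ n) N ->
  N `<=` add_set (scale_set (r ^+ n) N) (kernel_set (r ^+ n) N).
Proof.
move=> hN e v Nv.
have [w hw ew] : scale_set (r ^+ n) (scale_set (r ^+ n) N) (r ^+ n *: v).
  by rewrite -scale_setM -exprD e; exists v.
exists w => //; exists (v - w); last by rewrite addrC subrK.
split; last by rewrite /= scalerBr ew subrr.
by apply: submodB => //; apply: scale_set_sub hw.
Qed.

(** * Minimal submodules outside of an additive class *)

Section Minimal.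
Variable C : set V -> Prop.
Hypothesis hC : additive_class C.

Definition minimal_not N : Prop :=
  [/\ is_submodule N, ~ C N &
      forall K, is_submodule K -> K `<=` N -> ~ C K -> K = N].

Lemma minimal_not_ex N : artinian V -> is_submodule N -> ~ C N ->
  exists2 K, minimal_not K & K `<=` N.
Proof.
move=> aV hN nCN.
have [K [[hK nCK] KN hmin]] := @artinian_min
  (fun K => is_submodule K /\ ~ C K) N aV (fun K => @proj1 _ _) (conj hN nCN).
by exists K => //; split=> // K' hK' K'K nCK'; apply: hmin.
Qed.

(* For a minimal submodule outside of [C] multiplication by a ring element is
   onto or nilpotent, and the latter elements form a prime ideal: [N] is
   secondary, with [attached N] as attached prime. *)
Definition attached N : set R := [set r | C (scale_set r N)].

Lemma minimal_scale N r : minimal_not N -> ~ attached N r -> scale_set r N = N.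
Proof.
move=> [hN nCN hmin] nr; apply: hmin => //; first exact: submod_scale.
exact: scale_set_sub.
Qed.

(** If neither [r] nor [s] is attached, both map [N] onto itself, hence so does [r * s], and [N] is
    not in [C]. *)
Lemma attached_prime N : minimal_not N -> prime_ideal (attached N).
Proof.
move=> mN; have [hN nCN hmin] := mN; have [C0 CS CD] := hC; split.
- split.
  + by apply: CS C0 => _ [x _ <-]; exact: scale0r.
  + move=> r s Cr Cs; apply: CS (CD _ _ (submod_scale r hN) (submod_scale s hN) Cr Cs).
    move=> _ [x Nx <-]; exists (r *: x); first by exists x.
    by exists (s *: x); [exists x|rewrite scalerDl].
  + move=> a r Cr; rewrite /attached /= scale_setM.
    by apply: CS Cr; apply: scale_set_sub; exact: submod_scale.
- rewrite /attached /= => C1; apply: nCN; apply: CS C1 => x Nx.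
  by exists x; rewrite ?scale1r.
- move=> r s Crs; apply: contrapT => /not_orP[nr ns].
  by move: Crs; rewrite /attached /= scale_setM minimal_scale // minimal_scale.
Qed.

Lemma attached_nil N r : artinian V -> minimal_not N -> attached N r ->
  exists n, forall v, N v -> r ^+ n *: v = 0.
Proof.
move=> aV mN Cr; have [hN nCN hmin] := mN; have [C0 CS CD] := hC.
(* The exponent is made positive so that [r ^+ n.+1] maps [N] into [scale_set r N], which is in [C].
   By Fitting the kernel of [r ^+ n.+1] is then outside of [C], hence all of [N]. *)
have [n hn] := artinian_scaleX r aV hN; exists n.+1.
suff <- : kernel_set (r ^+ n.+1) N = N by move=> v [].
apply: hmin; [exact: submod_kernel|by move=> ? []|move=> Ck; apply: nCN].
have /CS : N `<=` add_set (scale_set (r ^+ n.+1) N) (kernel_set (r ^+ n.+1) N).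
  apply: fitting => //; rewrite (hn n.+1) // (hn (n.+1 + n.+1)%N) //.
  by rewrite addSn leqW ?leq_addr.
apply; apply: CD => //; [exact: submod_scale|exact: submod_kernel|].
rewrite exprS scale_setM; apply: CS Cr; apply: scale_setS; exact: scale_set_sub.
Qed.

End Minimal.

End Submodules.

Arguments acc {R V} N.
Arguments tame {R V} N.

(** * Prime chains from non-tame submodules *)

Section Dimension.
Variables (R : comPzRingType) (V : lmodType R).
Hypothesis aV : artinian V.
Implicit Types (N W : set V) (r y : R).

(* [D i] is the largest [y]-divisible submodule of [c i 0]; it is determined by
   its [y]-torsion, hence constant for large [i], and [c i.+1 0] exceeds it only
   by a submodule of [(0 :_N y ^+ n)]. *)
Lemma kernel_acc_tame y N : is_submodule N ->
  (forall v, N v -> exists n, y ^+ n *: v = 0) -> acc (kernel_set y N) -> tame N.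
Proof.
move=> hN nilN aK c hc cN cS cT.
have [n hn] := choice (fun i => artinian_scaleX y aV (hc i 0%N)).
pose D i := scale_set (y ^+ n i) (c i 0%N).
have hD i : is_submodule (D i) by exact: submod_scale.
have c0S i : c i 0%N `<=` c i.+1 0%N by exact: cT.
have Dc i : D i `<=` c i 0%N by exact: scale_set_sub.
have DN i : D i `<=` N by exact: subset_trans (Dc i) (cN i 0%N).
have DS i : D i `<=` D i.+1.
  rewrite /D -(hn i (maxn (n i) (n i.+1))) ?leq_maxl//.
  rewrite -(hn i.+1 (maxn (n i) (n i.+1))) ?leq_maxr//.
  exact: scale_setS.
have yD i : D i = scale_set y (D i).
  by rewrite /D -scale_setM -exprS hn.
have [|||i0 hi0] := aK (fun i => kernel_set y (D i)).
- by move=> i; exact: submod_kernel.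
- by move=> i; exact: setSI.
- by move=> i; exact: setSI.
exists i0 => i ii0.
(* Induction on the power of [y] killing [v]: [y *: v] lies in [D i = y D i], so [v] differs from an
   element of [D i] by [y]-torsion of [D i.+1], which is also that of [D i]. *)
have DE : D i.+1 `<=` D i.
  suff h k v : D i.+1 v -> y ^+ k *: v = 0 -> D i v.
    by move=> v Dv; have [k] := nilN v (DN _ _ Dv); exact: h.
  elim: k v => [|k IHk] v Dv.
    by rewrite scale1r => ->; exact: submod0.
  rewrite exprSr -scalerA => /(IHk _ (submodZ y (hD i.+1) Dv)).
  rewrite {1}yD => -[d Dd e].
  have : kernel_set y (D i.+1) (v - d).
    split; last by rewrite /= scalerBr e subrr.
    by apply: submodB => //; exact: DS.
  rewrite hi0 ?(leqW ii0)// -(hi0 i)// => -[Dvd _].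
  by rewrite -(subrK d v); exact: submodD.
(* Block [i] lies between [D i] and [c i.+1 0], itself contained in [D i] plus the kernel of a power
   of [y]. Every term meets [D i] in [D i], and that kernel is noetherian. *)
apply: (@stationary_add _ _ (D i) (kernel_set (y ^+ n i.+1) N)) => //.
- move=> j; apply: subset_trans (cT i j) _.
  apply: subset_trans (fitting (r := y) (n := n i.+1) (hc i.+1 0%N) _) _.
    by rewrite hn ?leq_addr.
  move=> _ [u hu [v [cv ev] <-]]; exists u; first exact: DE.
  by exists v => //; split=> //; exact: cN cv.
- exists 0%N => m _; rewrite !setIidr//.
  exact: subset_trans (Dc i) (chain_le (cS i) (leq0n m)).
- have aKn := acc_kernelX (n := n i.+1) hN aK; apply: aKn => j.
  + apply: submodI; first exact: submod_add.
    exact: submod_kernel.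
  + by move=> v [].
  + by apply: setSI; exact: add_setS.
Qed.

(** Every nonzero cyclic submodule of [W] is simple. Picking [w n] in [c n.+1] outside of [c n]
    along a strict chain gives independent elements, whose tails span a strictly decreasing
    sequence, against [aV]. *)
Lemma semisimple_acc W :
  (forall v, W v -> forall r, r *: v = 0 \/ exists s, s *: (r *: v) = v) ->
  acc W.
Proof.
move=> simW; apply: contrapT => /not_acc_strict[c [hc cW cS]].
have cS' n : c n `<=` c n.+1 by exact: properW.
have cL := chain_le cS'.
have /choice[w hw] : forall n, exists v, c n.+1 v /\ ~ c n v.
  move=> n; apply: contrapT => h; case: (cS n) => _; apply => v cv.
  by apply: contrapT => ncv; apply: h; exists v.
pose tail n := [set v | exists k (a : nat -> R), v = \sum_(n <= i < k) a i *: w i].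
have tailW n k m (a : nat -> R) : (k <= m)%N -> exists b : nat -> R,
    \sum_(n <= i < k) a i *: w i = \sum_(n <= i < m) b i *: w i.
  move=> km; exists (fun i => if (i < k)%N then a i else 0).
  rewrite (big_nat_widen _ _ _ _ _ km) big_mkcond /=.
  by apply: eq_bigr => i _; case: ifP => // _; rewrite scale0r.
have htail n : is_submodule (tail n).
  split.
  - by exists n, (fun=> 0); rewrite big_geq.
  - move=> _ _ [k [a ->]] [l [b ->]].
    have [a' ->] := tailW n k (maxn k l) a (leq_maxl _ _).
    have [b' ->] := tailW n l (maxn k l) b (leq_maxr _ _).
    exists (maxn k l), (fun i => a' i + b' i); rewrite -big_split /=.
    by apply: eq_bigr => i _; rewrite scalerDl.
  - move=> r _ [k [a ->]]; exists k, (fun i => r * a i).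
    by rewrite scaler_sumr; apply: eq_bigr => i _; rewrite scalerA.
have [|n /(_ n.+1 (leqnSn n)) e] := aV htail.
  move=> n _ [k [a ->]]; have [kn|nk] := leqP k n.
    by exists n, (fun=> 0); rewrite !big_geq // ltnW.
  exists k, (fun i => if i == n then 0 else a i).
  rewrite [RHS]big_ltn // eqxx scale0r add0r.
  by apply: eq_big_nat => i /andP[ni _]; rewrite gtn_eqF.
have : tail n (w n).
  exists n.+1, (fun=> 1); rewrite big_nat1 scale1r; reflexivity.
rewrite -e => -[k [a ewn]].
suff sum0 : \sum_(n.+1 <= i < k) a i *: w i = 0.
  by have [_] := hw n; rewrite ewn sum0; apply; exact: submod0.
have : c n.+1 (\sum_(n.+1 <= i < k) a i *: w i).
  by rewrite -ewn; have [] := hw n.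
(* The top term is stripped off: [a k *: w k] lies in [c k], so if it were nonzero simplicity would
   bring [w k] into [c k]. *)
elim: k {ewn} => [|k IHk]; first by rewrite big_geq.
have [kn _|nk] := ltnP k n.+1; first by rewrite big_geq.
rewrite big_nat_recr //=; set s := \sum_(_ <= i < _) _ => hs.
have cs : c k s.
  rewrite /s big_nat; apply: submod_sum => // i /andP[_ ik].
  by apply: submodZ => //; apply: cL ik _ _; have [] := hw i.
have akw : a k *: w k = 0.
  have [//|[r er]] := simW (w k) (cW _ _ (hw k).1) (a k).
  case: (hw k) => _ []; rewrite -er; apply: submodZ => //.
  by apply: submod_addKr cs _ => //; rewrite addrC; exact: cL hs.
by move: hs; rewrite akw addr0 => /IHk.
Qed.

(** [gs] plays the role of generators of the maximal ideal: they act locally nilpotently, and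
    nonzero elements of their common kernel generate simple submodules. *)
Variable gs : seq R.
Hypothesis nil_gs : forall g, g \in gs -> forall v : V, exists n, g ^+ n *: v = 0.
Hypothesis simple_gs : forall v : V, (forall g, g \in gs -> g *: v = 0) ->
  forall r, r *: v = 0 \/ exists s, s *: (r *: v) = v.

(** Let [K] be minimal non-noetherian in [W]. If the kernel of [g] on [K] were noetherian,
    [scale_set g K] would not be, so [g] would map [K] onto itself and nilpotency would force [K] to
    be zero. So every [g] in [gs] kills [K], which is then semisimple. *)
Lemma nilpotent_acc W : is_submodule W ->
  (forall g, g \in gs -> exists n, forall v, W v -> g ^+ n *: v = 0) -> acc W.
Proof.
move=> hW nilW; apply: contrapT => naW.
have [C0 CS _] := @acc_additive _ V.
have [K mK KW] := minimal_not_ex aV hW naW; have [hK naK hmin] := mK.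
apply: (naK); apply: semisimple_acc => v Kv; apply: simple_gs => g ggs.
have [n hn] := nilW g ggs.
suff e : kernel_set g K = K by move: Kv; rewrite -e => -[].
apply: (hmin); [exact: submod_kernel|by move=> ? []|move=> aK; apply: (naK)].
apply: (acc_ext hK aK); apply: contrapT => naI.
have gK : scale_set g K = K.
  by apply: hmin => //; [exact: submod_scale|exact: scale_set_sub].
apply: naK; apply: CS C0; suff h m : K = scale_set (g ^+ m) K.
  by rewrite (h n) => _ [x Kx <-]; exact/hn/KW.
elim: m => [|m IHm]; last by rewrite exprS scale_setM -IHm gK.
by apply/seteqP; split=> [x Kx|_ [x Kx <-]]; [exists x|]; rewrite ?scale1r.
Qed.

(* The chain of primes is [attached tame N < attached acc W < Ann v0], where [N]
   is minimal non-tame, [W] is minimal non-noetherian in the kernel on [N] of a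
   [y] in [gs] acting surjectively on [N], and [v0] lies in the socle of [W]. *)
Lemma not_tame_chain N : is_submodule N -> ~ tame N ->
  prime_chain (annihilator V) 2.
Proof.
move=> hN0 /(minimal_not_ex aV hN0)[{hN0}N' mN _]; move: N' mN => {}N mN.
have [hN ntN _] := mN.
have tC := @tame_additive _ V; have aC := @acc_additive _ V.
have pp := attached_prime tC mN.
(* Otherwise all of [gs] would be nilpotent on [N], making it noetherian and hence tame. *)
have [y [ygs yp]] : exists g, g \in gs /\ ~ attached tame N g.
  apply: contrapT => h; apply/ntN/acc_tame/nilpotent_acc => // g ggs.
  apply: (attached_nil tC aV mN); apply: contrapT => ng; apply: h.
  by exists g.
have naK : ~ acc (kernel_set y N).
  by move=> aK; apply: ntN; apply: kernel_acc_tame aK => // v _; exact: nil_gs.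
have [W mW WK] := minimal_not_ex aV (submod_kernel y hN) naK.
have WN : W `<=` N by move=> v /WK[].
have [hW naW _] := mW; have pq := attached_prime aC mW.
have [g [ggs gq]] : exists g, g \in gs /\ ~ attached acc W g.
  apply: contrapT => h; apply/naW/nilpotent_acc => // g ggs.
  apply: (attached_nil aC aV mW); apply: contrapT => ng; apply: h.
  by exists g.
have qpow r n : attached acc W (r ^+ n) -> attached acc W r.
  have [[q0 qD qZ] q1 qM] := pq; elim: n => [/q1//|n IHn].
  by rewrite exprS => /qM[//|/IHn].
have pq_sub : attached tame N `<=` attached acc W.
  move=> r /(attached_nil tC aV mN)[n hn]; apply: (qpow _ n).
  by have [C0 CS _] := aC; apply: CS C0 => _ [v Wv <-]; exact/hn/WN.
have yq : attached acc W y.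
  by have [C0 CS _] := aC; apply: CS C0 => _ [v /WK[_ h] <-].
(* A nonzero element of [W] is pushed into the kernels of the elements of [gs] one after the other,
   each time by the last power that does not kill it. *)
have [v0 [Wv0 v00 gv0]] : exists v,
    [/\ W v, v <> 0 & forall g, g \in gs -> g *: v = 0].
  have [w Ww w0] : exists2 w, W w & w <> 0.
    apply: contrapT => h; apply: naW; have [C0 CS _] := aC; apply: CS C0 => w Ww.
    by apply: contrapT => w0; apply: h; exists w.
  suff : forall s : seq R, {subset s <= gs} -> exists v,
      [/\ W v, v <> 0 & forall g, g \in s -> g *: v = 0] by apply.
  elim=> [_|x s IHs sub]; first by exists w.
  have [|v [Wv v0 hv]] := IHs; first by move=> z zs; rewrite sub// inE zs orbT.
  have [n] := nil_gs (sub x (mem_head x s)) v.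
  move=> /eqP hn; case: (ex_minnP (ex_intro (fun n => x ^+ n *: v == 0) n hn)).
  move=> [|k] /eqP hk kmin; first by case: v0; rewrite -hk scale1r.
  exists (x ^+ k *: v); split; first exact: submodZ.
    by move=> /eqP /kmin; rewrite ltnn.
  move=> z; rewrite inE => /orP[/eqP->|zs]; first by rewrite scalerA -exprS.
  by rewrite scalerA mulrC -scalerA hv// scaler0.
have pm : prime_ideal [set r | r *: v0 = 0].
  split.
  - split=> /= [|r s hr hs|a r /= hr]; first exact: scale0r.
      by rewrite scalerDl hr hs addr0.
    by rewrite -scalerA hr scaler0.
  - by rewrite /= scale1r.
  - move=> r s /= rs; have [->|[t e]] := simple_gs gv0 s; first by right.
    left; have -> : r *: v0 = t *: ((r * s) *: v0).
      by rewrite -{1}e !scalerA; congr (_ *: _); ring.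
    by rewrite rs scaler0.
have qm : attached acc W `<=` [set r | r *: v0 = 0].
  move=> r /(attached_nil aC aV mW)[n /(_ _ Wv0)]; have [_ m1 mM] := pm.
  elim: n => [/m1//|n IHn]; rewrite exprS => /mM[//|]; exact: IHn.
exists (fun i => if i is i'.+1 then
  if i' is _.+1 then [set r | r *: v0 = 0] else attached acc W
  else attached tame N).
have annp : annihilator V `<=` attached tame N.
  move=> r hr; have [C0 CS _] := tC.
  by apply: CS C0 => _ [v _ <-]; exact: hr.
split; case=> [|[|[|//]]] _ //.
- by split=> //; exact: subset_trans pq_sub.
- by split=> //; apply: subset_trans qm; exact: subset_trans pq_sub.
(* The two inclusions are strict because of [y] and of [g]. *)
- by split=> // /(_ _ yq).
- by split=> // /(_ g (gv0 _ ggs)).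
Qed.

End Dimension.

(** * Finite generation of the endomorphism ring *)

Section SubLmodule.
Variables (R : comPzRingType) (V : lmodType R) (N : set V).

(** The proof is an argument of the predicate so that the closure instance, and with it the module
    structure of the subtype, can be inferred. *)
Definition submod_pred of is_submodule N : {pred V} := fun x => `[< N x >].

Variable hN : is_submodule N.

Lemma submod_pred_closed : submod_closed (submod_pred hN).
Proof.
split; first by apply/asboolP; exact: submod0.
move=> r x y /asboolP hx /asboolP hy; apply/asboolP.
by apply: submodD => //; exact: submodZ.
Qed.
HB.instance Definition _ :=
  GRing.isSubmodClosed.Build R V (submod_pred hN) submod_pred_closed.

Definition sub_lmod : Type := {x : V | x \in submod_pred hN}.
HB.instance Definition _ := SubChoice.on sub_lmod.
HB.instance Definition _ := [SubChoice_isSubLmodule of sub_lmod by <:].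

Definition to_sub v (Nv : N v) : sub_lmod := exist _ v (asboolT Nv).

Lemma sub_lmodP (v : sub_lmod) : N (val v).
Proof. by apply/asboolP; exact: valP v. Qed.

End SubLmodule.

Section Generators.
Variable R : comPzRingType.
Implicit Types V T : lmodType R.

Definition generated V (s : seq V) : set V :=
  [set v | forall K, is_submodule K -> (forall i, i \in s -> K i) -> K v].

Lemma submod_generated V (s : seq V) : is_submodule (generated s).
Proof.
split=> [K hK _|x y hx hy K hK sK|r x hx K hK sK]; first exact: submod0.
  by apply: submodD => //; [exact: hx|exact: hy].
by apply: submodZ => //; exact: hx.
Qed.

Lemma generated_mem V (s : seq V) v : v \in s -> generated s v.
Proof. by move=> vs K _; apply. Qed.

Lemma generatedS V (s t : seq V) : {subset s <= t} -> generated s `<=` generated t.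
Proof. by move=> st v sv K hK tK; apply: sv => // i /st; exact: tK. Qed.

Lemma generatedP V (s : seq V) v : generated s v ->
  exists c : nat -> R, v = \sum_(i < size s) c i *: s`_i.
Proof.
move=> sv; apply: (sv [set v | exists c : nat -> R,
  v = \sum_(i < size s) c i *: s`_i]).
  split.
  - by exists (fun=> 0); rewrite big1 // => i _; rewrite scale0r.
  - move=> _ _ [a ->] [b ->]; exists (fun i => a i + b i).
    by rewrite -big_split /=; apply: eq_bigr => i _; rewrite scalerDl.
  - move=> r _ [a ->]; exists (fun i => r * a i).
    by rewrite scaler_sumr; apply: eq_bigr => i _; rewrite scalerA.
move=> w ws; exists (fun i => if i == index w s then 1 else 0).
have hi : (index w s < size s)%N by rewrite index_mem.
rewrite (bigD1 (Ordinal hi)) //= eqxx scale1r nth_index // big1 ?addr0//.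
by move=> i; rewrite -val_eqE /= => /negbTE ->; rewrite scale0r.
Qed.

Lemma submod_image V T (f : {linear T -> V}) (U : set T) :
  is_submodule U -> is_submodule (f @` U).
Proof.
move=> hU; split; first by exists 0; [exact: submod0|exact: linear0].
  move=> _ _ [x Ux <-] [y Uy <-]; exists (x + y); first exact: submodD.
  exact: linearD.
move=> r _ [x Ux <-]; exists (r *: x); first exact: submodZ.
exact: linearZ.
Qed.

(** Among the images of finitely generated submodules of [U], all inside the noetherian [K], a
    maximal one absorbs [f t] for every [t] in [U]. The generators are kept in [T], as lifts. *)
Lemma acc_generators V T (f : {linear T -> V}) (U : set T) (K : set V) :
  is_submodule U -> acc K -> f @` U `<=` K ->
  exists s : seq T, [/\ forall t, t \in s -> U t &
    forall t, U t -> exists2 t', generated s t' & f t' = f t].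
Proof.
move=> hU aK UK; pose F K' := exists s : seq T,
  (forall t, t \in s -> U t) /\ K' = f @` generated s.
have [||_ [s [sU ->]] smax] := @acc_max _ V K F (f @` generated [::]) aK.
- move=> _ [s [sU ->]]; split; first exact/submod_image/submod_generated.
  by move=> _ [t /(_ _ hU sU) Ut <-]; apply: UK; exists t.
- by exists [::].
exists s; split=> // t Ut.
have : (f @` generated (t :: s)) (f t).
  by exists t => //; apply: generated_mem; exact: mem_head.
apply: smax.
  exists (t :: s); split=> // u; rewrite inE => /orP[/eqP->//|]; exact: sU.
move=> _ [u su <-]; exists u => //; apply: generatedS su.
by move=> w ws; rewrite inE ws orbT.
Qed.

End Generators.

(** * Generators of modules of homomorphisms *)

Section Hom.
Variables (R : comPzRingType) (V E : lmodType R).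
Implicit Types f g : hom V E.

Definition mk_hom (f : V -> E) (hf : linear f) : hom V E :=
  exist _ f (asboolT hf).

Lemma hom_linear f : linear (val f).
Proof. by apply/asboolP; exact: (valP f). Qed.

Lemma homD f : {morph val f : x y / x + y}.
Proof. by move=> x y; have := hom_linear f 1 x y; rewrite !scale1r. Qed.
Lemma hom0 f : val f 0 = 0.
Proof. by apply: (addrI (val f 0)); rewrite -homD !addr0. Qed.
Lemma homZ f r : {morph val f : x / r *: x}.
Proof. by move=> x; have := hom_linear f r x 0; rewrite hom0 !addr0. Qed.
Lemma homB f : {morph val f : x y / x - y}.
Proof. by move=> x y; rewrite homD -scaleN1r homZ scaleN1r. Qed.

Lemma hom_addE f g v : val (f + g) v = val f v + val g v. Proof. by []. Qed.
Lemma hom_scaleE r f v : val (r *: f) v = r *: val f v. Proof. by []. Qed.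
Lemma hom_subE f g v : val (f - g) v = val f v - val g v. Proof. by []. Qed.
Lemma hom_sumE (I : Type) (s : seq I) (F : I -> hom V E) v :
  val (\sum_(i <- s) F i) v = \sum_(i <- s) val (F i) v.
Proof. by elim/big_rec2: _ => [//|i y x _ <-]. Qed.

Definition hom_eval v f : E := val f v.

Lemma hom_eval_linear v : linear (hom_eval v).
Proof. by []. Qed.
HB.instance Definition _ v :=
  GRing.isLinear.Build R (hom V E) E _ (hom_eval v) (hom_eval_linear v).

Lemma hom_eq_generated f g (s : seq V) v :
  (forall w, w \in s -> val f w = val g w) -> generated s v -> val f v = val g v.
Proof.
move=> fg /(_ [set w | val f w = val g w]); apply=> //.
split=> [|x y hx hy|r x hx] /=; first by rewrite !hom0.
  by rewrite !homD; congr (_ + _); [exact: hx|exact: hy].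
by rewrite !homZ; congr (_ *: _); exact: hx.
Qed.

(** Induction on [vs]: generators for the values on the tail leave an error vanishing on that tail,
    and evaluation at the head sends such maps into the noetherian [K]. *)
Lemma acc_hom_generators (K : set E) (vs : seq V) : acc K ->
  (forall f v, v \in vs -> K (val f v)) ->
  exists s : seq (hom V E), forall f, exists2 g, generated s g &
    forall v, v \in vs -> val g v = val f v.
Proof.
move=> aK; elim: vs => [_|v vs IHvs hK].
  by exists [::] => f; exists 0 => //; exact: (submod0 (submod_generated _)).
have [|s hs] := IHvs; first by move=> f w wvs; apply: hK; rewrite inE wvs orbT.
pose U := [set f : hom V E | forall w, w \in vs -> val f w = 0].
have hU : is_submodule U.
  split=> [w _|f g hf hg w wvs|r f hf w wvs] //.
    by rewrite hom_addE hf // hg // addr0.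
  by rewrite hom_scaleE hf // scaler0.
have [|s' [s'U hs']] := @acc_generators R E (hom V E) (hom_eval v) U K hU aK.
  by move=> _ [f _ <-]; apply: hK; exact: mem_head.
exists (s ++ s') => f; have [g sg hg] := hs f.
have [|g' sg' hg'] := hs' (f - g).
  by move=> w wvs; rewrite hom_subE hg // subrr.
exists (g + g').
  apply: (submodD (submod_generated _)).
    by apply: generatedS sg => w ws; rewrite mem_cat ws.
  by apply: generatedS sg' => w ws; rewrite mem_cat ws orbT.
move=> w; rewrite inE hom_addE => /orP[/eqP->|wvs].
  by have -> : val g' v = val f v - val g v := hg'; rewrite addrC subrK.
by rewrite hg // (sg' _ hU s'U) // addr0.
Qed.

End Hom.

(** * The determinant trick *)

Section Determinant.
Variable R : comPzRingType.

Lemma det_annihilates (V : lmodType R) d (B : 'M[R]_d) (u : 'I_d -> V) :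
  (forall j, \sum_l B j l *: u l = 0) -> forall k, \det B *: u k = 0.
Proof.
move=> Bu k; have : \sum_j (\adj B) k j *: (\sum_l B j l *: u l) = 0.
  by rewrite big1 // => j _; rewrite Bu scaler0.
under eq_bigr do rewrite scaler_sumr.
rewrite exchange_big /= => <-.
transitivity (\sum_l (\adj B *m B) k l *: u l).
  rewrite mul_adj_mx (bigD1 k) //= big1 ?addr0 ?mxE ?eqxx// => l lk.
  by rewrite mxE eq_sym (negbTE lk) scale0r.
apply: eq_bigr => l _; rewrite mxE scaler_suml.
by apply: eq_bigr => j _; rewrite scalerA.
Qed.

(** Congruence modulo [x], written [eqx], is compatible with sums and products, so it passes from
    the entries to the determinant. *)
Lemma det_scalar_sub d s x (M : 'M[R]_d) :
  exists r, \det (s%:M - x *: M) = s ^+ d + x * r.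
Proof.
pose eqx a b := exists r, a = b + x * r.
have eqxx a : eqx a a by exists 0; rewrite mulr0 addr0.
have eqxD a b a' b' : eqx a b -> eqx a' b' -> eqx (a + a') (b + b').
  by move=> [r ->] [r' ->]; exists (r + r'); ring.
have eqxM a b a' b' : eqx a b -> eqx a' b' -> eqx (a * a') (b * b').
  by move=> [r ->] [r' ->]; exists (r * b' + b * r' + x * r * r'); ring.
suff : eqx (\det (s%:M - x *: M)) (\det (s%:M : 'M[R]_d)) by rewrite det_scalar.
rewrite /determinant; elim/big_ind2: _ => [|a b a' b'|p _]; [exact: eqxx|exact: eqxD|].
apply: (eqxM) => //; elim/big_ind2: _ => [|a b a' b'|i _]; [exact: eqxx|exact: eqxM|].
by rewrite !mxE -mulrN; eexists.
Qed.

End Determinant.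

Section Integrality.
Variables (R : comPzRingType) (N : lmodType R) (x : R).
Hypothesis surj_x : forall v : N, exists w, x *: w = v.
Hypothesis nil_x : forall v : N, exists n, x ^+ n *: v = 0.
(** Completeness in the form used: power series in [x] are represented by elements of [R] as far as
    the action on [x]-power torsion is concerned. *)
Hypothesis series_x : forall a : nat -> R, exists r, forall n (v : N),
  x ^+ n *: v = 0 -> r *: v = \sum_(i < n) (a i * x ^+ i) *: v.
Hypothesis acc_x : acc [set v : N | x *: v = 0].

(** As [x] is onto, it identifies the quotient of [N] by its kernel with [N]. *)
Lemma hom_factor (f : hom N N) : (forall v, x *: v = 0 -> val f v = 0) ->
  exists g : hom N N, forall v, val f v = val g (x *: v).
Proof.
move=> f0; have [h hh] := choice surj_x.
have fE v w : x *: v = x *: w -> val f v = val f w.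
  move=> e; apply/eqP; rewrite -subr_eq0 -homB f0 // scalerBr e; exact: subrr.
have lg : linear (fun v => val f (h v)).
  move=> r v w; rewrite -homZ -homD; apply: fE.
  by rewrite scalerDr scalerA mulrC -scalerA !hh.
by exists (mk_hom lg) => v; apply: fE; rewrite hh.
Qed.

(* [End N / x End N] embeds into the noetherian [Hom (ker x, ker x)]; lifts of
   generators of the former generate [End N], by successive approximation. *)
Lemma end_finitely_generated : exists s : seq (hom N N), forall f,
  exists r : nat -> R, f = \sum_(j < size s) r j *: s`_j.
Proof.
have [|vs [vsK hvs]] := @acc_generators R N N idfun [set v : N | x *: v = 0] _
  (submod_ann N x) acc_x; first by move=> _ [v ? <-].
have [|s hs] := @acc_hom_generators R N N _ vs acc_x.
  by move=> f v /vsK xv0 /=; rewrite -homZ xv0 hom0.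
exists s => f0.
(* [f] agrees on the kernel of [x] with a combination of [s], so the difference factors through [x].
   Iterating expands [f0] in powers of [x]. *)
have step (f : hom N N) : exists c : (nat -> R) * hom N N, forall v,
    val f v = \sum_(j < size s) c.1 j *: val s`_j v + val c.2 (x *: v).
  have [g /generatedP[c gE] gf] := hs f.
  have [|h hh] := hom_factor (f := f - g).
    move=> v /hvs[w sw e]; have <- : w = v by [].
    by rewrite hom_subE (hom_eq_generated gf sw) subrr.
  exists (c, h) => v; have <- : val (f - g) v = val (c, h).2 (x *: v) by exact: hh.
  rewrite hom_subE gE hom_sumE.
  by under [X in _ - X]eq_bigr do rewrite hom_scaleE; rewrite addrC subrK.
have [c hc] := choice step; pose F n : hom N N := iter n (fun f => (c f).2) f0.
have FE n v : val f0 v = \sum_(i < n) \sum_(j < size s)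
    ((c (F i)).1 j * x ^+ i) *: val s`_j v + val (F n) (x ^+ n *: v).
  elim: n => [|n IHn]; first by rewrite big_ord0 add0r scale1r.
  rewrite IHn big_ord_recr /= -addrA; congr (_ + _).
  rewrite hc scalerA -exprS; congr (_ + _); apply: eq_bigr => j _.
  by rewrite homZ scalerA.
have [r hr] := choice (fun j => series_x (fun i => (c (F i)).1 j)).
exists r; apply: val_inj; apply/funext => v; rewrite hom_sumE.
under [RHS]eq_bigr do rewrite hom_scaleE.
have [n xv] := nil_x v; rewrite (FE n) xv hom0 addr0 exchange_big /=.
apply: eq_bigr => j _; rewrite (hr j n) ?scaler_suml //.
by rewrite -homZ xv hom0.
Qed.

(** Multiplication by [s] is [x] times an endomorphism [p]. With [M] the matrix of composition by
    [p] on the generators [ss], the determinant of [s - x M] kills their values, hence [N], as the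
    identity is a combination of [ss]. *)
Lemma kernel_annihilator s : (forall v : N, x *: v = 0 -> s *: v = 0) ->
  exists n r, forall v : N, (s ^+ n + x * r) *: v = 0.
Proof.
move=> sK.
have ls : linear (fun v : N => s *: v).
  by move=> r v w; rewrite scalerDr !scalerA mulrC.
have [|p hp] := hom_factor (f := mk_hom ls); first exact: sK.
have lid : linear (@idfun N) by [].
have [ss hss] := end_finitely_generated.
have lcomp (f : hom N N) : linear (val p \o val f).
  by move=> r v w /=; rewrite !homD !homZ.
have [m hm] := choice (fun f => hss (mk_hom (lcomp f))).
pose M := \matrix_(j < size ss, l < size ss) m ss`_j l.
have [r hr] := det_scalar_sub s x M; exists (size ss), r => v.
have [c hc] := hss (mk_hom lid).
have {}hc : v = \sum_(j < size ss) c j *: val ss`_j v.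
  by have := congr1 (fun f => val f v) hc; rewrite hom_sumE.
rewrite -hr hc scaler_sumr big1 // => k _.
rewrite scalerA mulrC -scalerA.
rewrite (det_annihilates (u := fun j : 'I_(size ss) => val ss`_j v)) ?scaler0// => j.
have : s *: val ss`_j v = x *: val p (val ss`_j v).
  by rewrite -[RHS]homZ -hp.
have -> : val p (val ss`_j v) = \sum_(l < size ss) m ss`_j l *: val ss`_l v.
  by have := congr1 (fun f => val f v) (hm ss`_j); rewrite hom_sumE.
move=> e; under eq_bigr do rewrite !mxE scalerBl.
rewrite sumrB; apply/eqP; rewrite subr_eq0; apply/eqP.
rewrite (bigD1 j) //= eqxx big1 => [|l lj]; last by rewrite eq_sym (negbTE lj) scale0r.
rewrite addr0 e scaler_sumr; apply: eq_bigr => l _; by rewrite scalerA.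
Qed.

End Integrality.

(** * Chains of type omega^2 from prime chains *)

Section Omega2.
Variables (R : comPzRingType) (V : lmodType R).

Lemma acc_sub_lmod (N W : set V) (hN : is_submodule N) : acc W ->
  acc [set v : sub_lmod hN | W (val v)].
Proof.
move=> aW c hc cW cS.
have [|||n hn] := aW (fun n => [set val v | v in c n]).
- move=> n; split; first by exists 0; [exact: submod0|].
    by move=> _ _ [u cu <-] [v cv <-]; exists (u + v); first exact: submodD.
  by move=> r _ [u cu <-]; exists (r *: u); first exact: submodZ.
- by move=> n _ [v cv <-]; exact: cW cv.
- by move=> n _ [v cv <-]; exists v => //; exact: cS.
exists n => m nm; apply/seteqP; split=> [v cv|]; last exact: chain_le.
have : [set val v | v in c m] (val v) by exists v.
by rewrite hn // => -[u cu /val_inj <-].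
Qed.

Lemma acc_nil (W : set V) y : is_submodule W -> acc W ->
  (forall v, W v -> exists n, y ^+ n *: v = 0) ->
  exists n, forall v, W v -> y ^+ n *: v = 0.
Proof.
move=> hW aW nilW; have [|||n hn] := aW (fun n => kernel_set (y ^+ n) W).
- by move=> n; exact: submod_kernel.
- by move=> n v [].
- by move=> n v [Wv /= e]; split=> //=; rewrite exprS -scalerA e scaler0.
exists n => v Wv; have [m e] := nilW v Wv.
have : kernel_set (y ^+ maxn n m) W v.
  split=> //=; rewrite -(subnK (leq_maxr n m)) exprD -scalerA e; exact: scaler0.
by rewrite hn ?leq_maxl// => -[].
Qed.

(** Block [i] consists of the preimages of the chain [w] under [x ^+ i], and lies between the
    kernels of [x ^+ i] and [x ^+ i.+1] on [N]. Strictness is inherited from [w] since [x ^+ i] is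
    onto. *)
Lemma omega2_of_kernel (N : set V) x : is_submodule N -> scale_set x N = N ->
  ~ acc (kernel_set x N) -> has_omega2_chain V.
Proof.
move=> hN xN /not_acc_strict[w [hw wK wS]].
have xnN n : scale_set (x ^+ n) N = N.
  elim: n => [|n IHn]; last by rewrite exprS scale_setM IHn.
  by apply/seteqP; split=> [_ [v Nv <-]|v Nv]; [|exists v]; rewrite ?scale1r.
pose c (p : nat *l nat) := N `&` [set v | w p.2 (x ^+ p.1 *: v)].
have cS i j j' : (j <= j')%N -> c (i, j) `<=` c (i, j').
  move=> jj' v [Nv cv]; split=> //=.
  by apply: chain_le jj' _ cv => n; exact: properW.
have cn i j : ~ (c (i, j.+1) `<=` c (i, j)).
  move=> cc; apply: (wS j).2 => v wv; have /wK[Nv _] := wv.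
  move: Nv; rewrite -(xnN i) => -[u Nu uv].
  have : c (i, j.+1) u by split=> //=; rewrite uv.
  by move=> /cc[_ /=]; rewrite uv.
have cT i j i' j' : (i < i')%N -> c (i, j) `<=` c (i', j').
  move=> ii' v [Nv cv]; split=> //=; have [_ /= e] := wK _ _ cv.
  rewrite -(subnK ii') exprD -scalerA exprS -[(x * _) *: v]scalerA e scaler0.
  exact: submod0.
exists c; split=> [p|[i j] [i' j']]; first by apply: submodI => //; exact: submod_preim.
rewrite leEprodlexi.
have [ii'|ii'|<-] := ltngtP i i'.
- rewrite !leEnat (ltnW ii') leqNgt ii' /=; split=> // _; exact: cT.
- rewrite !leEnat leqNgt ii' /=; split=> // h; exfalso; apply: (@cn i' j').
  exact: subset_trans (cT i' j'.+1 i j ii') h.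
- rewrite !leEnat leqnn /=; split=> [/cS//|h].
  rewrite leqNgt; apply/negP => j'j; apply: (@cn i j'); apply: subset_trans h.
  exact: cS.
Qed.

Hypothesis aV : artinian V.
Hypothesis nil_nonunits : forall x, nonunits x ->
  forall v : V, exists n, x ^+ n *: v = 0.
Hypothesis series_nonunits : forall x, nonunits x -> forall a : nat -> R,
  exists r, forall n (v : V),
    x ^+ n *: v = 0 -> r *: v = \sum_(i < n) (a i * x ^+ i) *: v.

Lemma prime_nonunits (P : set R) x : prime_ideal P -> P x -> nonunits x.
Proof.
move=> [hP P1 _] Px [y yx]; apply: P1; rewrite -yx; exact: (idealMl y hP).
Qed.

(* [N] is minimal among the submodules with annihilator inside the smallest
   prime [p 0]; elements outside of [p 0] act surjectively on it. *)
Lemma chain_omega2 : prime_chain (annihilator V) 2 -> has_omega2_chain V.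
Proof.
move=> [p [hp pS]].
have [pp0 Vp0] := hp 0%N isT; have [pp1 _] := hp 1%N isT.
have [pp2 _] := hp 2%N isT.
have [p01 np10] := pS 0%N isT; have [p12 np21] := pS 1%N isT.
have [x p1x p0x] : exists2 x, p 1%N x & ~ p 0%N x.
  apply: contrapT => h; apply: np10 => x p1x; apply: contrapT => p0x.
  by apply: h; exists x.
have [y p2y p1y] : exists2 y, p 2 y & ~ p 1%N y.
  apply: contrapT => h; apply: np21 => y p2y; apply: contrapT => p1y.
  by apply: h; exists y.
have nx := prime_nonunits pp1 p1x; have ny := prime_nonunits pp2 p2y.
pose F N := is_submodule N /\
  (forall r, (forall v : V, N v -> r *: v = 0) -> p 0%N r).
have [||N [[hN Np0] _ Nmin]] := @artinian_min _ _ F setT aV.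
- by move=> K [].
- by split; [exact: submodT|move=> r hr; apply: Vp0 => v; exact: hr].
(* If [r] kills [scale_set x N], then [r * x] kills [N] and lies in [p 0]; as [x] does not, [r]
   does, so minimality applies. *)
have xN : scale_set x N = N.
  apply: Nmin; last exact: scale_set_sub.
  split; first exact: submod_scale.
  move=> r hr; have /Np0 : forall v, N v -> (r * x) *: v = 0.
    by move=> v Nv; rewrite -scalerA; apply: hr; exists v.
  by case: pp0 => _ _ pM /pM[].
apply: (omega2_of_kernel hN xN) => aK.
have [n hn] := acc_nil (submod_kernel x hN) aK (fun v _ => nil_nonunits ny v).
have [|||||k [r hr]] := @kernel_annihilator R (sub_lmod hN) x _ _ _ _ (y ^+ n).
- move=> v; have := sub_lmodP v; rewrite -{1}xN => -[w Nw e].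
  by exists (to_sub hN Nw); apply: val_inj.
- move=> v; have [m e] := nil_nonunits nx (val v).
  by exists m; apply: val_inj; rewrite linearZ.
- move=> a; have [s hs] := series_nonunits nx a; exists s => m v e.
  apply: val_inj; rewrite raddf_sum; apply: hs.
  by have := congr1 val e.
- have := @acc_sub_lmod N _ hN aK; have [_ CS _] := @acc_additive R (sub_lmod hN).
  apply: CS => v /= e; split; first exact: sub_lmodP.
  exact: (congr1 val e).
- move=> v e; apply: val_inj; apply: hn.
  by split; [exact: sub_lmodP|exact: (congr1 val e)].
(* This element kills [N], so it lies in [p 0], hence in [p 1]; since [x] is in [p 1], so is a power
   of [y], against the choice of [y]. *)
have : p 1%N (y ^+ n ^+ k + x * r).
  by apply/p01/Np0 => v Nv; exact: (congr1 val (hr (to_sub hN Nv))).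
have [hp1 p11 p1M] := pp1.
have p1X z m : p 1%N (z ^+ m) -> p 1%N z.
  by elim: m => [/p11//|m IHm]; rewrite exprS => /p1M[|/IHm].
move=> h; apply/p1y/(p1X y n)/(p1X _ k).
by apply: (submod_addKr hp1 _ h); rewrite mulrC; exact: (idealMl r hp1).
Qed.

End Omega2.

(** * The completion of a local ring *)

Section CompletionTheory.
Variables (L : comPzRingType) (I : set L).
Local Notation R := (completion I).
Implicit Types (r x : R) (l : L).

Lemma ideal_powD m n a b : ideal_pow I m a -> ideal_pow I n b ->
  ideal_pow I (m + n) (a * b).
Proof.
move=> ha hb; elim: m a ha => [|m IHm] a ha.
  exact: (idealMl a (ideal_pow_ideal I n)).
have hJ := ideal_pow_ideal I (m.+1 + n).
apply: (ha [set a | ideal_pow I (m.+1 + n) (a * b)]); split.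
- split=> [|c d hc hd|c d hd]; rewrite /mkset; first by rewrite mul0r; exact: ideal0.
    by rewrite mulrDl; exact: (idealD hJ).
  by rewrite -[c *: d]/(c * d) -mulrA; exact: (idealMl c hJ).
- by move=> _ [i Ii [j /IHm Jj <-]]; rewrite /mkset -mulrA; exact: ideal_mulM.
Qed.

Lemma ideal_pow_exp n a : I a -> ideal_pow I n (a ^+ n).
Proof. by move=> Ia; elim: n => [//|n IHn]; rewrite exprS; exact: ideal_mulM. Qed.

Lemma ideal_pow1 a : I a -> ideal_pow I 1 a.
Proof. by move=> Ia; rewrite -[a]mulr1; exact: ideal_mulM. Qed.

Lemma cauchy_cst l : (fun=> l) \in cauchy_pred I.
Proof.
apply/asboolP => n; exists 0%N => i j _ _; rewrite subrr.
exact: (ideal0 (ideal_pow_ideal I n)).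
Qed.

Definition cst l : cauchy_seq I :=
  exist (fun c => c \in cauchy_pred I) (fun=> l) (cauchy_cst l).
Definition emb l : R := \pi_(completion I) (cst l).

(** The kernel of the map from the completion to [L] modulo [I ^ n]; this filtration takes the place
    of the powers of an ideal of the completion. *)
Definition deep n r : Prop := exists2 c : cauchy_seq I,
  r = \pi_(completion I) c &
  exists k, forall i, (k <= i)%N -> ideal_pow I n (val c i).

Lemma completion_piB (c d : cauchy_seq I) :
  \pi_(completion I) (c - d) = \pi_(completion I) c - \pi_(completion I) d.
Proof. by apply/esym/eqP; rewrite subr_eq -completion_piD subrK. Qed.

Lemma completion_piM (c d : cauchy_seq I) :
  \pi_(completion I) (c * d) = \pi_(completion I) c * \pi_(completion I) d.
Proof. by rewrite [RHS]completion_mulE. Qed.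

Lemma deepD n r x : deep n r -> deep n x -> deep n (r + x).
Proof.
move=> [c -> [k hk]] [d -> [m hm]]; exists (c + d); first by rewrite completion_piD.
exists (maxn k m) => i; rewrite geq_max => /andP[ki mi].
by apply: (idealD (ideal_pow_ideal I n)); [exact: hk|exact: hm].
Qed.

Lemma deepM m n r x : deep m r -> deep n x -> deep (m + n) (r * x).
Proof.
move=> [c -> [k hk]] [d -> [l hl]]; exists (c * d); first by rewrite completion_piM.
exists (maxn k l) => i; rewrite geq_max => /andP[ki li].
by apply: ideal_powD; [exact: hk|exact: hl].
Qed.

Lemma deep_le m n r : (m <= n)%N -> deep n r -> deep m r.
Proof.
move=> mn [c -> [k hk]]; exists c => //; exists k => i ki.
exact: ideal_pow_le mn _ (hk i ki).
Qed.

Lemma deep_0 r : deep 0 r.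
Proof. by elim/quotW: r => c; exists c => //; exists 0%N. Qed.

Lemma deepMl n r x : deep n x -> deep n (r * x).
Proof. by move=> hx; rewrite -[n]add0n; apply: deepM => //; exact: deep_0. Qed.

Lemma deepN n r : deep n r -> deep n (- r).
Proof. by move=> h; rewrite -mulN1r; exact: deepMl. Qed.

Lemma deepB n r x : deep n r -> deep n x -> deep n (r - x).
Proof. by move=> hr hx; apply: deepD => //; exact: deepN. Qed.

Lemma deepX n r : deep 1 r -> deep n (r ^+ n).
Proof.
by move=> h; elim: n => [|n IHn]; [exact: deep_0|rewrite exprS; exact: deepM h IHn].
Qed.

Lemma emb_deep n l : deep n (emb l) -> ideal_pow I n l.
Proof.
move=> [c /completion_piP /asboolP/(_ n)[k hk] [m hm]].
rewrite -(subrK (val c (maxn k m)) l).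
apply: (idealD (ideal_pow_ideal I n)); last by apply: hm; exact: leq_maxr.
by apply: hk; exact: leq_maxl.
Qed.

Lemma embB a b : emb (a - b) = emb a - emb b.
Proof. by rewrite /emb -completion_piB; congr (\pi _); exact: val_inj. Qed.

Lemma deep_approx n r : exists l, deep n (r - emb l).
Proof.
elim/quotW: r => c; have /asboolP/(_ n)[k hk] := valP c.
exists (val c k), (c - cst (val c k)); first by rewrite completion_piB.
by exists k => i ki; apply: hk.
Qed.

Lemma deep_limit (l : nat -> L) :
  (forall n, ideal_pow I n (l n.+1 - l n)) ->
  exists r, forall n, deep n (r - emb (l n)).
Proof.
move=> hl; have lS n m : (n <= m)%N -> ideal_pow I n (l m - l n).
  elim: m => [|m IHm].
    rewrite leqn0 => /eqP->; rewrite subrr; exact: (ideal0 (ideal_pow_ideal I 0)).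
  rewrite leq_eqVlt => /orP[/eqP->|nm].
    by rewrite subrr; exact: (ideal0 (ideal_pow_ideal I _)).
  have -> : l m.+1 - l n = (l m.+1 - l m) + (l m - l n) by ring.
  apply: (idealD (ideal_pow_ideal I n)); last exact: IHm.
  by rewrite ltnS in nm; exact: ideal_pow_le nm _ (hl m).
have cl : l \in cauchy_pred I.
  apply/asboolP => n; exists n => i j ni nj.
  have -> : l i - l j = (l i - l n) - (l j - l n) by ring.
  by apply: (idealB (ideal_pow_ideal I n)); exact: lS.
pose c : cauchy_seq I := exist (fun c => c \in cauchy_pred I) l cl.
exists (\pi_(completion I) c) => n; exists (c - cst (l n)).
  by rewrite completion_piB.
by exists n => i ni; exact: lS.
Qed.

Lemma deep_series x (a : nat -> R) : deep 1 x ->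
  exists r, forall n, deep n (r - \sum_(i < n) a i * x ^+ i).
Proof.
move=> hx; pose t n := \sum_(i < n) a i * x ^+ i.
(* Partial sums are replaced by elements of [L] up to depth [n]; these form a Cauchy sequence, whose
   class is the limit. *)
have [l hl] := choice (fun n => deep_approx n (t n)).
have [|r hr] := @deep_limit l.
  move=> n; apply: emb_deep.
  have -> : emb (l n.+1 - l n) =
      (t n - emb (l n)) - (t n.+1 - emb (l n.+1)) + a n * x ^+ n.
    by rewrite embB /t big_ord_recr /=; ring.
  apply: deepD; last by apply: deepMl; exact: deepX.
  by apply: deepB => //; apply: deep_le (hl n.+1).
exists r => n; have -> : r - t n = (r - emb (l n)) - (t n - emb (l n)) by ring.
exact: deepB.
Qed.

Lemma deep_kill (W : lmodType L)
    (tors : forall v : W, exists n, forall a, ideal_pow I n a -> a *: v = 0)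
    n r (v : W) :
  (forall a, ideal_pow I n a -> a *: v = 0) -> deep n r ->
  completion_scale r v = 0.
Proof.
move=> hv [c -> [k hk]]; apply: (completion_scaleE tors).
by exists k => i ki; exact/hv/hk.
Qed.

End CompletionTheory.

(** If the sequence is not eventually in [I], then beyond the point where its terms agree modulo [I]
    none lies in [I]. They are then units, and their inverses form a Cauchy sequence. *)
Lemma nonunits_deep (L : comPzRingType) (r : completion (@nonunits L)) :
  nonunits r -> deep 1 r.
Proof.
set I := @nonunits L; elim/quotW: r => c ncr; exists c => //.
apply: contrapT => h; have /asboolP/(_ 1%N)[k hk] := valP c.
have ck i : (k <= i)%N -> ~ I (val c i).
  move=> ki /ideal_pow1 Ici; apply: h; exists k => j kj.
  rewrite -(subrK (val c i) (val c j)).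
  by apply: (idealD (ideal_pow_ideal I 1)) => //; exact: hk.
have /choice[d hd] : forall i, exists y, (k <= i)%N -> y * val c i = 1.
  move=> i; have [ki|ik] := leqP k i; last by exists 0.
  by have /contrapT[y yc] := ck i ki; exists y.
have cd : d \in cauchy_pred I.
  apply/asboolP => n; have /asboolP/(_ n)[m hm] := valP c.
  exists (maxn k m) => i j; rewrite !geq_max => /andP[ki mi] /andP[kj mj].
  have -> : d i - d j = d i * d j * (val c j - val c i).
    rewrite mulrBr -{1}mulrA hd // mulr1 [d i * d j]mulrC -mulrA hd //.
    by rewrite mulr1.
  by apply: (idealMl _ (ideal_pow_ideal I n)); exact: hm.
apply: ncr; pose d' : cauchy_seq I := exist (fun c => c \in cauchy_pred I) d cd.
exists (\pi_(completion I) d'); rewrite -completion_piM; apply/completion_piP.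
apply/asboolP => n; exists k => i ki.
rewrite -[val _ i]/(d i * val c i - 1) hd // subrr.
exact: (ideal0 (ideal_pow_ideal I n)).
Qed.

(** * Primary components over the completion *)

Section ComponentTheory.
Variables (A : comPzRingType) (P : maxIdeal A) (Q : lmodType A).
Local Notation R := (completed_localization P).
Local Notation C := (component P Q).
Local Notation V := (completed_component P Q).
Local Notation frac a := (mkfrac a (den1 P)).

Definition embA (a : A) : R := emb (@nonunits (localization P)) (frac a).

Lemma embA_scale a (v : V) : embA a *: v = (a *: (v : C) : V).
Proof.
apply: (completion_scaleE (@loc_component_tors A P Q)).
by exists 0%N => i _; apply: loc_scaleE; rewrite scale1r.
Qed.

Lemma embA_scaleX a n (v : V) : embA a ^+ n *: v = (a ^+ n *: (v : C) : V).
Proof.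
elim: n v => [|n IHn] v; first by rewrite !scale1r.
by rewrite !exprSr -!scalerA embA_scale IHn.
Qed.

(** On a single [v] the class of a Cauchy sequence acts as one fraction [a / s], and [s] is
    invertible modulo a power of [P] killing the result. The [a] found depends on [v], which
    suffices to compare submodules over both rings. *)
Lemma completed_scale (r : R) (v : V) : exists a : A, r *: v = (a *: (v : C) : V).
Proof.
elim/quotW: r => c.
have [k /(_ k (leqnn k))] := completion_scaleP (@loc_component_tors A P Q) c v.
have [a [s ->]] := mkfrac_ex (val c k).
rewrite -[LHS]/(loc_scale (mkfrac a s) v); set y := completion_scale _ _ => e.
have ye : \pi_(completion _) c *: v = y by [].
have sy : val s *: (y : C) = a *: (v : C) by rewrite -e; exact: loc_scaleP.
have [n hn] := component_tors (y : C).
have [t /hn/eqP] := max_ideal_pow_inv n (denP s).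
rewrite scalerBl scale1r subr_eq0 => /eqP yE.
by exists (t * a); rewrite [LHS]ye yE -!scalerA sy.
Qed.

Lemma completed_submodule (N : set C) :
  is_submodule N <-> is_submodule (N : set V).
Proof.
split=> -[N0 ND NZ]; split=> // r v Nv.
  by have [a ->] := completed_scale r v; exact: NZ.
by have := NZ (embA r) v Nv; rewrite embA_scale.
Qed.

Lemma completed_artinian : artinian Q -> artinian V.
Proof.
move=> aQ N hN NS; have {}hN n : @is_submodule A C (N n) by exact/completed_submodule.
have [||n hn] := aQ (fun n => [set val v | v in N n : set C]).
- move=> n; have [h0 hD hZ] := hN n; split; first by exists 0.
    by move=> _ _ [u cu <-] [v cv <-]; exists (u + v); first exact: hD.
  by move=> r _ [u cu <-]; exists (r *: u); first exact: hZ.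
- by move=> n _ [v cv <-]; exists v => //; exact: NS.
exists n => m nm; apply/seteqP; split=> v Nv.
  have : [set val v | v in N m : set C] (val (v : C)) by exists v.
  by rewrite hn // => -[u Nu /val_inj <-].
have : [set val v | v in N n : set C] (val (v : C)) by exists v.
by rewrite -(hn m nm) => -[u Nu /val_inj <-].
Qed.

Lemma completed_nonunit_nil (x : R) : nonunits x ->
  forall v : V, exists n, x ^+ n *: v = 0.
Proof.
move=> /nonunits_deep hx v; have [n hn] := @loc_component_tors A P Q v.
exists n; exact: (deep_kill (@loc_component_tors A P Q) hn (deepX n hx)).
Qed.

Lemma completed_nonunit_series (x : R) : nonunits x -> forall a : nat -> R,
  exists r, forall n (v : V),
    x ^+ n *: v = 0 -> r *: v = \sum_(i < n) (a i * x ^+ i) *: v.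
Proof.
move=> /nonunits_deep hx a; have [r hr] := deep_series a hx.
exists r => n v xv; have [m hm] := @loc_component_tors A P Q v.
(* On [v] the limit acts as the partial sum of length [maxn n m], whose terms of index at least [n]
   vanish. *)
have /eqP : (r - \sum_(i < maxn n m) a i * x ^+ i) *: v = 0.
  apply: (deep_kill (@loc_component_tors A P Q) hm).
  exact: deep_le (leq_maxr n m) (hr _).
rewrite scalerBl subr_eq0 => /eqP ->; rewrite scaler_suml.
rewrite -!(big_mkord xpredT (fun i => (a i * x ^+ i) *: v)).
rewrite (big_cat_nat (leq0n n) (leq_maxl n m)) /= [X in _ + X]big_nat.
rewrite [X in _ + X]big1 ?addr0//.
move=> i /andP[ni _]; rewrite -(subnK ni) exprD mulrA -scalerA xv; exact: scaler0.
Qed.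

Lemma component_nil g (v : C) : (P : set A) g -> exists n, g ^+ n *: v = 0.
Proof.
by move=> Pg; have [n hn] := component_tors v; exists n; apply/hn/ideal_pow_exp.
Qed.

Lemma completed_simple (v : V) : (forall g, (P : set A) g -> g *: (v : C) = 0) ->
  forall r : R, r *: v = 0 \/ exists s, s *: (r *: v) = v.
Proof.
move=> Pv r; have [a ->] := completed_scale r v.
have [Pa|/max_ideal_inv[t /Pv/eqP]] := pselect ((P : set A) a).
  by left; exact: Pv.
rewrite scalerBl scale1r subr_eq0 => /eqP e; right; exists (embA t).
by rewrite embA_scale scalerA -e.
Qed.

(** Finite generation of [P], expressed by annihilation so that it applies to elements of any
    module. *)
Lemma maxIdeal_generators : noetherian_ring A -> exists s : seq A,
  (forall g, g \in s -> (P : set A) g) /\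
  forall (W : lmodType A) (w : W), (forall g, g \in s -> g *: w = 0) ->
    forall g, (P : set A) g -> g *: w = 0.
Proof.
move=> nA; have aA : acc [set: A^o] by move=> c hc _ cS; exact: nA.
have [//|s [sP hs]] := @acc_generators A A^o A^o idfun (P : set A) setT
  (max_ideal_ideal P) aA.
exists s; split=> // W w sw g /hs[g' sg' /= <-].
apply: (sg' [set g : A^o | (g : A) *: w = 0]) => //.
split=> /= [|a b ha hb|a b hb]; first exact: scale0r.
  by rewrite scalerDl ha hb addr0.
by rewrite -[a *: b]/(a * b) -scalerA hb scaler0.
Qed.

Lemma component_not_tame_chain (N : set V) : noetherian_ring A -> artinian Q ->
  is_submodule N -> ~ tame N -> prime_chain (annihilator V) 2.
Proof.
move=> nA aQ; have [s [sP hs]] := maxIdeal_generators nA.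
apply: (@not_tame_chain R V (completed_artinian aQ) (map embA s)).
- move=> _ /mapP[g /sP Pg ->] v; have [n e] := @component_nil g v Pg.
  by exists n; rewrite embA_scaleX.
- move=> v hv; apply: completed_simple; apply: (hs C v) => g gs.
  by rewrite -[LHS]embA_scale hv //; apply: map_f.
Qed.

Lemma component_chain_omega2 : artinian Q ->
  prime_chain (annihilator V) 2 -> has_omega2_chain Q.
Proof.
move=> aQ /(chain_omega2 (completed_artinian aQ) completed_nonunit_nil
  completed_nonunit_series)[c [hc cc]].
exists (fun p => [set val v | v in c p : set C]); split=> [p|p q].
  have [h0 hD hZ] : @is_submodule A C (c p) by exact/completed_submodule.
  split; first by exists 0.
    by move=> _ _ [u cu <-] [v cv <-]; exists (u + v); first exact: hD.
  by move=> r _ [u cu <-]; exists (r *: u); first exact: hZ.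
split=> [/cc pq _ [v cv <-]|pq]; first by exists v => //; exact: pq.
apply/cc => v cv; have [|u cu /val_inj <- //] := pq (val (v : C)).
by exists v.
Qed.

End ComponentTheory.

(** * Divisible groups *)

Lemma zorn_above (T : Type) (P : set (set T)) (A0 : set T) : P A0 ->
  (forall F : set (set T), F !=set0 -> F `<=` P -> total_on F subset ->
    P (\bigcup_(X in F) X)) ->
  exists A, [/\ P A, A0 `<=` A & forall B, P B -> A `<=` B -> B = A].
Proof.
move=> PA0 hP; pose P' X := X = set0 \/ (P X /\ A0 `<=` X).
have [F FP' Ft|A [PA Amax]] := @Zorn_bigcup T P'.
  pose F' := F `&` [set X | P X /\ A0 `<=` X].
  have FF' : \bigcup_(X in F) X = \bigcup_(X in F') X.
    apply/seteqP; split=> x [X FX Xx]; last by exists X => //; case: FX.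
    by exists X => //; split=> //; have [X0|//] := FP' X FX; move: Xx; rewrite X0.
  have [F'0|/set0P[X F'X]] := eqVneq F' set0.
    by left; rewrite FF' F'0 bigcup_set0.
  right; rewrite FF'; split; last first.
    by move=> x A0x; exists X => //; case: F'X => _ [_]; apply.
  apply: hP; [by exists X|by move=> Y [_ []]|].
  by move=> Y Z [FY _] [FZ _]; exact: Ft.
have {PA}[A_0|[PA A0A]] := PA.
  have A00 : A0 = set0.
    apply: contrapT => A0n; apply: (Amax A0); last by right; split.
    by rewrite A_0; split=> //; rewrite subset0.
  exists A0; split=> // B PB A0B; apply: contrapT => BA0.
  apply: (Amax B); last by right; split=> //; rewrite A00; exact: sub0set.
  by rewrite A_0; split=> //; rewrite subset0 => B0; apply: BA0; rewrite B0 A00.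
exists A; split=> // B PB AB; apply: contrapT => BA.
apply: (Amax B); last by right; split=> //; exact: subset_trans AB.
by split=> // BA'; apply: BA; apply/seteqP.
Qed.

Section Divisible.
Variables (V D : zmodType).
Hypothesis divD : forall (n : nat) (d : D), (0 < n)%N -> exists e, e *+ n = d.

(* Graphs of additive maps to [D] defined on a subgroup of [V]. *)
Definition graph (G : set (V * D)) : Prop :=
  [/\ G 0, forall p q, G p -> G q -> G (p - q) & forall d, G (0, d) -> d = 0].

Lemma graphN G p : graph G -> G p -> G (- p).
Proof. by move=> [G0 GB _] Gp; rewrite -sub0r; exact: GB. Qed.

Lemma graphD G p q : graph G -> G p -> G q -> G (p + q).
Proof.
by move=> gG Gp Gq; rewrite -[q]opprK; have [_ GB _] := gG; apply: GB => //; exact: graphN.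
Qed.

Lemma graphM G v d (m : int) : graph G -> G (v, d) -> G (v *~ m, d *~ m).
Proof.
move=> gG Gp; have [G0 _ _] := gG.
have h n : G (v *+ n, d *+ n).
  elim: n => [|n IHn]; first by rewrite !mulr0n.
  by rewrite !mulrS -[(_, _)]/((v, d) + (v *+ n, d *+ n)); exact: graphD.
case: m => n; first exact: h.
by rewrite !NegzE !mulrNz -[(_, _)]/(- (v *+ n.+1, d *+ n.+1)); exact: graphN.
Qed.

(** The integers [m] with [v *~ m] in the domain of [G] form an ideal. Divisibility gives an [e]
    with the right value at its positive generator [k]; when the ideal is zero, [e = 0] serves. *)
Lemma graph_value G v : graph G -> exists e, forall m c, G (v *~ m, c) -> c = e *~ m.
Proof.
move=> gG; have [G0 GB G1] := gG.
have [[k hk]|nk] := pselect (exists k, (0 < k)%N /\ exists d, G (v *+ k, d)); last first.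
  exists 0 => m c Gm; rewrite mul0rz.
  have [m0|m0] := eqVneq m 0; first by move: Gm; rewrite m0 mulr0z; exact: G1.
  exfalso; apply: nk; exists `|m|%N; split; first by rewrite absz_gt0.
  have := graphM (sgz m) gG Gm; rewrite -mulrzA [m * _]mulrC -abszEsg => h.
  by eexists; exact: h.
have : exists k, `[< (0 < k)%N /\ exists d, G (v *+ k, d) >] by exists k; exact/asboolP.
case/ex_minnP => {k hk} k /asboolP[k0 [d Gd]] kmin.
have [e ed] := divD d k0; exists e => m c Gm.
have mE := divz_eq m k; set q := (m %/ k)%Z in mE; set r := (m %% k)%Z in mE.
have r0 : 0 <= r by apply: modz_ge0; rewrite -lt0n.
have rk : r < k by apply: ltz_pmod.
have Gq := graphM q gG Gd.
have : G (v *~ m - v *+ k *~ q, c - d *~ q) by exact: GB Gm Gq.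
rewrite {1}mE mulrzDr mulrC pmulrn -mulrzA addrAC subrr add0r.
move: r0 rk; case: (r) mE => // -[|n] mE _ nk.
  rewrite mulr0z => /G1/eqP; rewrite subr_eq0 => /eqP ->.
  by rewrite -ed pmulrn -mulrzA mE addr0 mulrC.
move=> Gr; suff : (k <= n.+1)%N by rewrite leqNgt -ltz_nat nk.
by apply: kmin; apply/asboolP; split=> //; eexists; exact: Gr.
Qed.

Lemma graph_extend G : graph G -> exists g : V -> D,
  (forall x y, g (x + y) = g x + g y) /\ forall v d, G (v, d) -> g v = d.
Proof.
move=> gG; have [F [X FX] FP Ft|H [gH GH Hmax]] := @zorn_above _ graph G gG.
  have chain p q : (\bigcup_(X in F) X) p -> (\bigcup_(X in F) X) q ->
      exists X, [/\ F X, X p & X q].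
    move=> [Y FY Yp] [Z FZ Zq]; have [YZ|ZY] := Ft Y Z FY FZ.
      by exists Z; split=> //; exact: YZ.
    by exists Y; split=> //; exact: ZY.
  split.
  - by exists X => //; have [] := FP X FX.
  - move=> p q /chain h /h[Y [FY Yp Yq]]; exists Y => //.
    by have [_ YB _] := FP Y FY; exact: YB.
  - by move=> d [Y FY Y0]; have [_ _] := FP Y FY; apply.
have [H0 HB H1] := gH.
have /choice[g hg] : forall v, exists d, H (v, d).
  move=> v; have [e he] := graph_value v gH; exists e.
  (* The maximal graph [H] enlarged by the multiples of [(v, e)]; the choice of [e] keeps it
     single-valued. *)
  pose H' := [set p | exists2 q, H q & exists m : int,
    p = (q.1 + v *~ m, q.2 + e *~ m)].
  suff <- : H' = H by exists 0 => //; exists 1; rewrite !add0r !mulr1z.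
  apply: Hmax; last first.
    by move=> [a b] Hq; exists (a, b) => //; exists 0; rewrite !mulr0z !addr0.
  split.
  - by exists 0 => //; exists 0; rewrite !mulr0z !addr0.
  - move=> _ _ [[a b] Hp [m ->]] [[a' b'] Hq [n ->]].
    exists ((a, b) - (a', b')); first exact: HB.
    exists (m - n); rewrite !mulrzBr.
    rewrite -[LHS]/((a + v *~ m) - (a' + v *~ n), (b + e *~ m) - (b' + e *~ n)).
    by rewrite !opprD [a + _ + _]addrACA [b + _ + _]addrACA.
  - move=> d [[a b] Hp [m [/esym/eqP + ->]]] /=.
    rewrite addr_eq0 => /eqP aE; have := graphN gH Hp.
    rewrite -[- (a, b)]/(- a, - b) aE opprK => /he <-; exact: subrr.
have Hfun v d d' : H (v, d) -> H (v, d') -> d = d'.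
  move=> Hd Hd'; apply/eqP; rewrite -subr_eq0; apply/eqP/H1.
  by rewrite -(subrr v) -[(_, _)]/((v, d) - (v, d')); exact: HB.
exists g; split=> [x y|v d Gd]; last by apply: Hfun (hg v) (GH _ Gd).
apply: Hfun (hg _) _; rewrite -[(_, _)]/((x, g x) + (y, g y)); exact: graphD.
Qed.

End Divisible.

(** * Characters with values in Q / Z *)

Section RatModInt.

Definition int_rat : {pred rat} := fun q => `[< exists z : int, q = z%:~R >].

Lemma int_rat_zmod : zmod_closed int_rat.
Proof.
split; first by apply/asboolP; exists 0.
move=> p q /asboolP[z ->] /asboolP[t ->]; apply/asboolP.
by exists (z - t); rewrite rmorphB.
Qed.
HB.instance Definition _ := GRing.isZmodClosed.Build rat int_rat int_rat_zmod.

Definition rat_mod_int : Type := Quotient.quot int_rat.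
HB.instance Definition _ := GRing.Zmodule.on rat_mod_int.
HB.instance Definition _ :=
  EqQuotient.copy rat_mod_int (Quotient.quot int_rat).

Local Open Scope quotient_scope.

Lemma rat_mod_int_piM q n :
  \pi_rat_mod_int (q *+ n) = (\pi_rat_mod_int q : rat_mod_int) *+ n.
Proof.
elim: n => [|n IHn]; first by rewrite !mulr0n !piE.
by rewrite !mulrS -IHn !piE.
Qed.

Lemma rat_mod_int_pi0 q : \pi_rat_mod_int q = 0 <-> exists z : int, q = z%:~R.
Proof.
have -> : (0 : rat_mod_int) = \pi_rat_mod_int 0 by rewrite !piE.
split=> [/eqP|h].
  by rewrite -(Quotient.idealrBE int_rat) subr0 => /asboolP.
by apply/eqP; rewrite -(Quotient.idealrBE int_rat) subr0; apply/asboolP.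
Qed.

Lemma rat_mod_int_div (n : nat) (d : rat_mod_int) : (0 < n)%N -> exists e, e *+ n = d.
Proof.
elim/quotW: d => q n0; exists (\pi_rat_mod_int (q / n%:R)).
by rewrite -rat_mod_int_piM -[q / _ *+ n]mulr_natr divfK // pnatr_eq0 -lt0n.
Qed.

Lemma nonzero_character (K : zmodType) (k : K) : k <> 0 ->
  exists2 g : K -> rat_mod_int, forall x y, g (x + y) = g x + g y & g k <> 0.
Proof.
move=> k0.
(* [n] is the order of [k], or 2 if [k] has infinite order. Then [k] may be sent to the class of
   [1 / n], nonzero since [n] exceeds 1. *)
have [n n1 hn] : exists2 n, (1 < n)%N & forall m : int, k *~ m = 0 -> (n %| m)%Z.
  have [[n hn]|h] := pselect (exists n, (0 < n)%N /\ k *+ n = 0); last first.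
    exists 2%N => // m km; suff -> : m = 0 by exact: dvdz0.
    apply: contrapT => /eqP m0; apply: h; exists `|m|%N.
    by rewrite absz_gt0 m0 pmulrn abszEsg mulrC mulrzA km mul0rz.
  have : exists n, (0 < n)%N && (k *+ n == 0).
    by exists n; have [-> ->] := hn; rewrite eqxx.
  case/ex_minnP => {n hn} n /andP[n0 /eqP kn] nmin; exists n.
    by case: n n0 kn {nmin} => [|[|n]].
  move=> m km; apply/dvdz_mod0P.
  have := divz_eq m n; have : 0 <= (m %% n)%Z by apply: modz_ge0; rewrite -lt0n.
  have : (m %% n)%Z < n by apply: ltz_pmod.
  case: (m %% n)%Z => // -[//|r] rn _ mE; suff : (n <= r.+1)%N.
    by rewrite leqNgt -ltz_nat rn.
  apply: nmin; rewrite /= pmulrn; apply/eqP; move: km.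
  by rewrite mE mulrzDr mulrC mulrzA -pmulrn kn mul0rz add0r.
pose d := \pi_rat_mod_int (n%:R^-1 : rat).
have n0 : n%:R != 0 :> rat by rewrite pnatr_eq0 -lt0n ltnW.
have dn : d *+ n = 0.
  rewrite -rat_mod_int_piM -[_^-1 *+ n]mulr_natr mulVf //.
  by apply/rat_mod_int_pi0; exists 1.
have [|g [gD gG]] := graph_extend rat_mod_int_div
    (G := [set p : K * rat_mod_int | exists m : int, p = (k *~ m, d *~ m)]).
  split; first by exists 0; rewrite !mulr0z.
    by move=> _ _ [m ->] [l ->]; exists (m - l); rewrite !mulrzBr.
  move=> c [m [/esym/hn/dvdzP[q ->] ->]].
  by rewrite mulrC mulrzA -pmulrn dn mul0rz.
exists g => //; rewrite (gG k d); last by exists 1; rewrite !mulr1z.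
move=> /rat_mod_int_pi0[z zE].
have : (z * n)%:~R = 1 :> rat by rewrite rmorphM /= -zE mulVf.
move=> /eqP; rewrite (_ : 1 = 1%:~R)// eqr_int => /eqP zn.
have : absz (z * n) = 1%N by rewrite zn.
rewrite abszM /= => /eqP; rewrite muln_eq1 => /andP[_ /eqP n1'].
by rewrite n1' in n1.
Qed.

End RatModInt.

(** * Injective hulls of residue fields *)

Definition linear_of (R : comPzRingType) (U V : lmodType R) (f : U -> V)
  (hf : linear f) : {linear U -> V} :=
  HB.pack f (GRing.isLinear.Build R U V *:%R f hf).

Section Characters.
Variable R : comPzRingType.
Local Notation D := rat_mod_int.

Definition character_pred : {pred R -> D} :=
  fun f => `[< forall x y, f (x + y) = f x + f y >].

Lemma character_zmod : zmod_closed character_pred.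
Proof.
split; first by apply/asboolP => x y; rewrite [RHS]addr0.
move=> f g /asboolP hf /asboolP hg; apply/asboolP => x y.
rewrite -[LHS]/(f (x + y) - g (x + y)) hf hg opprD; exact: addrACA.
Qed.
HB.instance Definition _ :=
  GRing.isZmodClosed.Build (R -> D) character_pred character_zmod.

(* [Hom_Z (R, Q / Z)] *)
Definition character_module : Type := {f : R -> D | f \in character_pred}.
HB.instance Definition _ := SubChoice.on character_module.
HB.instance Definition _ := [SubChoice_isSubZmodule of character_module by <:].

Definition mk_character (f : R -> D) (hf : forall x y, f (x + y) = f x + f y) :
  character_module := exist (fun f => f \in character_pred) f (asboolT hf).

Lemma characterD (f : character_module) x y : val f (x + y) = val f x + val f y.
Proof. by have /asboolP := valP f. Qed.

Lemma character_scale_subproof (r : R) (f : character_module) x y :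
  val f (r * (x + y)) = val f (r * x) + val f (r * y).
Proof. by rewrite mulrDr characterD. Qed.

Definition character_scale r f := mk_character (character_scale_subproof r f).

Lemma character_eq (f g : character_module) : val f =1 val g -> f = g.
Proof. by move=> fg; apply: val_inj; exact/funext. Qed.

Lemma character_scaleA r s f :
  character_scale r (character_scale s f) = character_scale (r * s) f.
Proof. by apply: character_eq => x /=; rewrite mulrA [s * r]mulrC. Qed.
Lemma character_scale1 : left_id 1 character_scale.
Proof. by move=> f; apply: character_eq => x /=; rewrite mul1r. Qed.
Lemma character_scaleDr : right_distributive character_scale +%R.
Proof. by move=> r f g; exact: character_eq. Qed.
Lemma character_scaleDl f : {morph character_scale^~ f : r s / r + s}.
Proof.
by move=> r s; apply: character_eq => x; rewrite /= mulrDl; exact: characterD.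
Qed.
HB.instance Definition _ := GRing.Zmodule_isLmodule.Build R character_module
  character_scaleA character_scale1 character_scaleDr character_scaleDl.

(** One direction of the adjunction between restriction of scalars to Z and [Hom_Z (R, -)]. *)
Lemma characters_linear (V : lmodType R) (g : V -> D) :
  (forall x y, g (x + y) = g x + g y) ->
  exists h : {linear V -> character_module},
    forall v r, val (h v) r = g (r *: v).
Proof.
move=> gD; have hD v x y : g ((x + y) *: v) = g (x *: v) + g (y *: v).
  by rewrite scalerDl gD.
have hl : linear (fun v => mk_character (hD v)).
  move=> r v w; apply: character_eq => x.
  rewrite -[RHS]/(g ((r * x) *: v) + g (x *: w)) /= scalerDr gD scalerA.
  by rewrite [x * r]mulrC.
by exists (linear_of hl).
Qed.

(** The values of [f] at 1 form an additive map, which extends to [V] by divisibility; the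
    adjunction turns the extension into a linear map. *)
Lemma character_module_injective : injective_module character_module.
Proof.
move=> U V i f inji.
have [|g [gD gG]] := graph_extend rat_mod_int_div
    (G := [set p : V * D | exists u, p = (i u, val (f u) 1)]).
  split; first by exists 0; rewrite !linear0.
    by move=> _ _ [u ->] [v ->]; exists (u - v); rewrite !linearB.
  by move=> d [u [/esym + ->]]; rewrite -(linear0 i) => /inji ->; rewrite linear0.
have [h hE] := characters_linear gD; exists h => u; apply: character_eq => r.
rewrite hE -linearZ (gG _ (val (f (r *: u)) 1)); last by exists (r *: u).
by rewrite linearZ -[LHS]/(val (f u) (r * 1)) mulr1.
Qed.

End Characters.

Section InjectiveHull.
Variables (R : comPzRingType) (K E0 : lmodType R) (j0 : {linear K -> E0}).
Hypotheses (injE0 : injective_module E0) (inj_j0 : injective j0).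

Definition essential (N : set E0) : Prop :=
  [/\ is_submodule N, range j0 `<=` N &
    forall x, N x -> x <> 0 -> exists2 r, r *: x <> 0 & range j0 (r *: x)].

Lemma essential_maximal : exists2 N, essential N &
  forall M, essential M -> N `<=` M -> M = N.
Proof.
have [||N [hN _ Nmax]] := @zorn_above _ essential (range j0); last by exists N.
  split=> // [|x hx x0]; first exact: submod_image (@submodT _ _).
  by exists 1; rewrite scale1r.
move=> F [X FX] FP Ft; split.
- split; first by exists X => //; have [[]] := FP X FX.
    move=> x y [Y FY Yx] [Z FZ Zy]; have [YZ|ZY] := Ft Y Z FY FZ.
      by exists Z => //; have [hZ _ _] := FP Z FZ; apply: submodD => //; exact: YZ.
    by exists Y => //; have [hY _ _] := FP Y FY; apply: submodD => //; exact: ZY.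
  by move=> r x [Y FY Yx]; exists Y => //; have [hY _ _] := FP Y FY; exact: submodZ.
- by have [_ XR _] := FP X FX; move=> x /XR Xx; exists X.
- by move=> x [Y FY Yx]; have [_ _] := FP Y FY; exact.
Qed.

(** [C] is maximal among the submodules meeting [N] trivially; the last clause spells out maximality
    for elements. *)
Lemma complement_ex (N : set E0) : is_submodule N -> exists C : set E0,
  [/\ is_submodule C, forall x, C x -> N x -> x = 0 &
    forall x, ~ C x -> exists c r, [/\ C c, N (c + r *: x) & c + r *: x <> 0]].
Proof.
move=> hN; pose P (C : set E0) := is_submodule C /\ forall x, C x -> N x -> x = 0.
have [||C [[hC C0] _ Cmax]] := @zorn_above _ P [set 0].
- by split=> //; exact: submod_zero.
- move=> F [X FX] FP Ft; split.
    split; first by exists X => //; have [[]] := FP X FX.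
      move=> x y [Y FY Yx] [Z FZ Zy]; have [YZ|ZY] := Ft Y Z FY FZ.
        by exists Z => //; have [hZ _] := FP Z FZ; apply: submodD => //; exact: YZ.
      by exists Y => //; have [hY _] := FP Y FY; apply: submodD => //; exact: ZY.
    by move=> r x [Y FY Yx]; exists Y => //; have [hY _] := FP Y FY; exact: submodZ.
  by move=> x [Y FY Yx]; have [_] := FP Y FY; apply.
exists C; split=> // x nCx; apply: contrapT => h.
pose B := add_set C (cyclic_set x).
have hx := submod_cyclic x.
apply: nCx; rewrite -(Cmax B).
- by apply: add_setr => //; exists 1; rewrite scale1r.
- split; first exact: submod_add.
  move=> _ [c Cc [_ [r ->] <-]] Ncr; apply: contrapT => n0.
  by apply: h; exists c, r.
- exact: add_setl.
Qed.

(* A maximal essential extension [N] of [K] in the injective [E0] is a direct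
   summand: project [N + C] to [N], where [C] is a complement, and extend the
   projection to [E0]; its image is again an essential extension of [K]. *)
Lemma injective_hull_ex : exists E : lmodType R, injective_hull K E.
Proof.
have [N [hN NK Ness] Nmax] := essential_maximal.
have [C [hC CN0 Cmax]] := complement_ex hN.
have hU := submod_add hN hC.
have /choice[p hp] : forall u : sub_lmod hU, exists e, N e /\ C (val u - e).
  move=> u; have [e Ne [c Cc <-]] := sub_lmodP u; exists e; split=> //.
  by rewrite addrC addKr.
have pE u e : N e -> C (val u - e) -> p u = e.
  move=> Ne Ce; have [Np Cp] := hp u; apply/eqP; rewrite -subr_eq0; apply/eqP.
  apply: CN0; last exact: submodB.
  by rewrite -(subrKA (val u)) -[p u - _]opprB addrC; exact: submodB.
have lp : linear p.
  move=> r u v; have [Nu Cu] := hp u; have [Nv Cv] := hp v; apply: pE.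
    by apply: submodD => //; exact: submodZ.
  have -> : val (r *: u + v) - (r *: p u + p v) =
      r *: (val u - p u) + (val v - p v).
    by rewrite linearP scalerBr opprD; exact: addrACA.
  by apply: submodD => //; exact: submodZ.
have lval : linear (fun u : sub_lmod hU => val u) by [].
have [g hg] := injE0 (linear_of lp) (i := linear_of lval) val_inj.
have gN e : N e -> g e = e.
  move=> Ne; rewrite -[g e]/(g (linear_of lval (to_sub hU (add_setl hC Ne)))) hg.
  by apply: pE => //=; rewrite subrr; exact: submod0.
have gC c : C c -> g c = 0.
  move=> Cc; rewrite -[g c]/(g (linear_of lval (to_sub hU (add_setr hN Cc)))) hg.
  by apply: pE => /=; rewrite ?subr0 //; exact: submod0.
(* If [g x] is nonzero, [x] is not in [C], so some [c + r *: x] is a nonzero element of [N]; it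
   equals [r *: g x]. Hence the image of [g] is essential over [K]. *)
have rN : range g = N.
  apply: Nmax; last by move=> e Ne; exists e => //; exact: gN.
  split; first exact: submod_image (@submodT _ _).
    by apply: subset_trans NK _ => e Ne; exists e => //; exact: gN.
  move=> _ [x _ <-] gx0; have [|c [r [Cc Ne e0]]] := Cmax x.
    by move=> /gC.
  have re : r *: g x = c + r *: x by rewrite -[RHS]gN // linearD (gC _ Cc) add0r linearZ.
  have [s se sK] := Ness _ Ne e0.
  by exists (s * r); rewrite -scalerA re.
have gr x : N (g x) by rewrite -rN; exists x.
pose E := sub_lmod hN.
have lret : linear (fun x => to_sub hN (gr x) : E).
  by move=> r x y; apply: val_inj; rewrite /= linearP.
have lj : linear (fun w => to_sub hN (NK _ (imageT j0 w)) : E).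
  by move=> r x y; apply: val_inj; rewrite /= linearP.
exists E; split.
- move=> U V i f inji.
  have lf : linear (fun u => val (f u)) by move=> r x y; rewrite linearP.
  have [h hh] := injE0 (linear_of lf) inji.
  have lh : linear (fun v => to_sub hN (gr (h v)) : E).
    by move=> r x y; apply: val_inj; rewrite /= !linearP.
  exists (linear_of lh) => u; apply: val_inj => /=; rewrite hh.
  by apply: gN; exact: sub_lmodP.
- exists (linear_of lj); first by move=> x y /(congr1 val)/inj_j0.
  move=> M hM [x Mx x0]; have [|r rx0 [w _ e]] := Ness (val x) (sub_lmodP x).
    by move=> e; move: x0; rewrite (_ : x = 0) ?eqxx//; exact: val_inj.
  exists (r *: x); last first.
    by apply/eqP => /(congr1 val); exact: rx0.
  split; first exact: submodZ.
  by exists w => //; apply: val_inj.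
Qed.

End InjectiveHull.

Section ResidueHull.
Variable R : comPzRingType.
Implicit Types V E : lmodType R.

(** A character not vanishing at [k] induces a map from [K] to [character_module R]; it is injective
    because every nonzero [w] has [k] as a multiple. *)
Lemma simple_hull_ex (K : lmodType R) (k : K) : k <> 0 ->
  (forall w : K, w <> 0 -> exists s : R, s *: w = k) ->
  exists E : lmodType R, injective_hull K E.
Proof.
move=> k0 simK; have [g gD gk] := nonzero_character k0.
have [h hE] := characters_linear gD.
apply: (injective_hull_ex (j0 := h) (@character_module_injective R)).
move=> x y e; apply/eqP; rewrite -subr_eq0; apply/eqP; apply: contrapT.
move=> /simK[s sk]; apply: gk; rewrite -sk -hE linearB e subrr.
by [].
Qed.

(** The residue field is realized as the span of [v]: units do not kill [v], and a nonunit, being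
    nilpotent on [v], cannot act invertibly, so it kills [v]. *)
Lemma residue_hull_ex V (v : V) : v <> 0 ->
  (forall r, r *: v = 0 \/ exists s, s *: (r *: v) = v) ->
  (forall r, nonunits r -> exists n, r ^+ n *: v = 0) ->
  exists E : lmodType R, residue_hull E.
Proof.
move=> v0 simv nilv; pose K := sub_lmod (submod_cyclic v).
pose q r : K := to_sub (submod_cyclic v) (ex_intro _ r erefl).
have lq : linear (q : R^o -> K).
  move=> r x y; apply: val_inj => /=.
  by rewrite -[r *: x]/(r * x) scalerDl scalerA.
have q0 r : q r = 0 <-> r *: v = 0.
  by split=> [/(congr1 val)//|e]; exact: val_inj.
have [|w w0|E hE] := @simple_hull_ex K (q 1).
- by move=> /q0; rewrite scale1r.
- have [r wr] := sub_lmodP w; have [rv|[s sv]] := simv r.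
    by case: w0; apply: val_inj; rewrite wr rv.
  exists s; apply: val_inj.
  by rewrite -[LHS]/(s *: val w) -[RHS]/(1 *: v) scale1r wr.
exists E, K => //; exists (linear_of lq).
  by move=> w; have [r wr] := sub_lmodP w; exists r; exact: val_inj.
move=> r; split=> [/q0 rv [y yr]|nr].
  by apply: v0; rewrite -[v]scale1r -yr -scalerA rv scaler0.
apply/q0; have [//|[s sv]] := simv r; exfalso; have [n rn] := nilv r nr.
apply: v0; elim: n rn => [|n IHn]; first by rewrite scale1r.
move=> e; apply: IHn; rewrite -{1}sv !scalerA.
have -> : r ^+ n * (s * r) = s * r ^+ n.+1 by rewrite exprS; ring.
by rewrite -scalerA e scaler0.
Qed.

(** If [u = a *: v] is nonzero, only nonunits kill it, so [r *: u] may be sent to the residue class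
    of [r]. Extended to [V] by injectivity of [E], this map is not killed by [a]. *)
Lemma annihilator_hom V E : residue_hull E ->
  annihilator (hom V E) `<=` annihilator V.
Proof.
move=> [K [q _ qE] [injE [j injj _]]] a aE v; apply: contrapT => av.
pose u := a *: v; pose U := sub_lmod (submod_cyclic u).
have /choice[p hp] : forall w : U, exists r : R, val w = r *: u.
  by move=> w; exact: sub_lmodP w.
have pE w r : val w = r *: u -> q (p w) = q r.
  move=> e; apply/eqP; rewrite -subr_eq0 -linearB; apply/eqP/qE => -[y yr].
  apply: av; rewrite -/u -[u]scale1r -yr -scalerA scalerBl -hp -e subrr.
  exact: scaler0.
have lf : linear (fun w => j (q (p w))).
  move=> r x y; rewrite -linearP; congr (j _).
  rewrite -[X in _ = X]linearP; apply: pE.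
  rewrite -[r *: (p x : R^o)]/(r * p x) scalerDl -scalerA -!hp.
  by rewrite linearP.
have lval : linear (fun w : U => val w) by [].
have [g hg] := injE _ _ (linear_of lval) (linear_of lf) val_inj.
have u1 : cyclic_set u u by exists 1; rewrite scale1r.
have := hg (to_sub (submod_cyclic u) u1).
rewrite -[LHS]/(g (a *: v)) -[RHS]/(j (q (p _))).
rewrite (pE _ 1) /= ?scale1r // linearZ => e.
have lg : linear g by exact: linearP.
have ag : a *: g v = 0 := congr1 (fun f : hom V E => val f v) (aE (mk_hom lg)).
have : j (q 1) = j 0 by rewrite linear0 -e; exact: ag.
by move=> /injj /qE; apply; exists 1; rewrite mulr1.
Qed.

End ResidueHull.

(** * Reduction to primary components *)

(** [supremum] takes its default value when no least upper bound exists, so existence must be known.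
    For a set with an integer bound [b] and an integer element, the least [n] with [b - n] in the
    set gives a maximum. *)
Lemma supremums_bar_int (S : set (\bar int)) : S !=set0 -> supremums S !=set0.
Proof.
move=> [d0 Sd0].
have [[b hb]|unb] := pselect (exists b : int, forall d, S d -> (d <= b%:E)%E);
    last first.
  exists +oo%E; split=> [d _|e he]; first exact: leey.
  have : (d0 <= e)%E by exact: he.
  case: e he => [e he _|//|he d0N]; exfalso; apply: unb; first by exists e.
  by exists 0 => d /he /le_trans; apply; rewrite leNye.
have [[z Sz]|noz] := pselect (exists z : int, S z%:E); last first.
  have SN d : S d -> d = -oo%E.
    by case: d => [z Sz|/hb|//]; [exfalso; apply: noz; exists z|].
  exists -oo%E; split=> [d /SN ->//|e he]; exact: leNye.
have : exists n : nat, `[< S (b - n%:Z)%:E >].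
  exists `|b - z|%N; apply/asboolP.
  by rewrite gez0_abs ?subKr // subr_ge0 -lee_fin; exact: hb.
case/ex_minnP => n /asboolP Sn nmin; exists (b - n%:Z)%:E; split=> [d Sd|e]; last first.
  exact.
case: d Sd => [d Sd|/hb//|_]; last exact: leNye.
have db : d <= b by rewrite -lee_fin; exact: hb.
have : (n <= `|b - d|)%N.
  by apply: nmin; apply/asboolP; rewrite gez0_abs ?subKr ?subr_ge0.
rewrite -lez_nat gez0_abs ?subr_ge0 // lee_fin => h.
by rewrite lerBrDl -lerBrDr.
Qed.

Lemma supremum_bar_int_le (S : set (\bar int)) (z : \bar int) :
  (supremum -oo%E S <= z)%E <-> forall d, S d -> (d <= z)%E.
Proof.
split=> [h d Sd|h].
  apply: le_trans h; apply: ge_supremum_Nmem => //.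
  by apply: supremums_bar_int; exists d.
have [->|/set0P S0] := eqVneq S set0; first by rewrite supremum0 leNye.
rewrite /supremum ifF; last by apply/negbTE/set0P.
case: xgetP => [y _ [_ hy]|_]; [exact: hy|exact: leNye].
Qed.

Lemma krull_dim_le1 (R : comPzRingType) (M : lmodType R) :
  (krull_dim M <= 1%:E)%E <-> ~ prime_chain (annihilator M) 2.
Proof.
rewrite supremum_bar_int_le; split=> [h pc|npc _ [n [p [hp pS]] <-]].
  by have := h (Posz 2)%:E (ex_intro2 _ _ 2%N pc erefl).
rewrite lee_fin lez_nat leqNgt; apply/negP => n2; apply: npc.
by exists p; split=> i i2; [apply: hp|apply: pS]; apply: leq_trans n2.
Qed.

Section Reduction.
Variables (A : comPzRingType) (Q : lmodType A).
Hypotheses (nA : noetherian_ring A) (aQ : artinian Q).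

Lemma omega2_not_tame : has_omega2_chain Q -> ~ tame [set: Q].
Proof.
move=> [c [hc cc]] /(_ (fun i j => c (i, j))) [||||i0 /(_ i0 (leqnn _)) st].
- by move=> i j; exact: hc.
- by [].
- by move=> i j; apply/cc; rewrite leEprodlexi /= lexx leEnat leqnSn.
- move=> i j; apply/cc; rewrite leEprodlexi /= !leEnat leqnSn.
  by rewrite ltnn.
- apply: (stationary_strict st) => j /cc.
  by rewrite leEprodlexi /= !leEnat leqnn ltnn.
Qed.

(** A minimal submodule [Y] of [N] not inside [X] is generated by any of its elements outside of
    [X], so its quotient by [X] is simple. This yields associated primes for [X = 0] and is the
    descent step in the primary decomposition. *)
Lemma artinian_maximal_ideal (X N : set Q) : is_submodule X -> is_submodule N ->
  ~ N `<=` X -> exists y, [/\ N y, ~ X y & maximal_ideal [set a | X (a *: y)]].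
Proof.
move=> hX hN NX; pose F Y := [/\ is_submodule Y, Y `<=` N & ~ Y `<=` X].
have [||Y [[hY YN YX] _ Ymin]] := @artinian_min _ _ F N aQ; first by move=> ? [].
  by split.
have [y Yy Xy] : exists2 y, Y y & ~ X y.
  by apply: contrapT => h; apply: YX => y Yy; apply: contrapT => Xy; apply: h; exists y.
have cyc z : Y z -> ~ X z -> cyclic_set z = Y.
  move=> Yz Xz.
  have zY : cyclic_set z `<=` Y by move=> _ [r ->]; exact: submodZ.
  apply: Ymin => //; split; [exact: submod_cyclic|exact: subset_trans YN|].
  by move=> /(_ z); apply: contra_not Xz; apply; exists 1; rewrite scale1r.
exists y; split=> //; first exact: YN.
split.
- split; first by rewrite /mkset scale0r; exact: submod0.
    by move=> a b ha hb; rewrite /mkset scalerDl; exact: submodD.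
  by move=> a b hb; rewrite /mkset -[a *: b]/(a * b) -scalerA; exact: submodZ.
- by rewrite /mkset scale1r.
- move=> J hJ IJ; have [JI|nJI] := pselect (J `<=` [set a | X (a *: y)]).
    by left; apply/seteqP.
  right; have [a Ja Xay] : exists2 a, J a & ~ X (a *: y).
    by apply: contrapT => h; apply: nJI => a Ja; apply: contrapT => Xa; apply: h; exists a.
  have : cyclic_set (a *: y) y by rewrite cyc //; exact: submodZ.
  move=> [b yb]; have J1 : J 1.
    rewrite -(subrK (b * a) 1); apply: (idealD hJ); last exact: idealMl.
    apply: IJ; rewrite /mkset scalerBl scale1r -scalerA -yb subrr.
    exact: submod0.
  by apply/seteqP; split=> // r _; rewrite -[r]mulr1; exact: idealMl.
Qed.

Definition prime_torsion (P : maxIdeal A) : set Q :=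
  [set v | v \in @component_pred A P Q].
(** The kernel of the localization map of [Q] at [P]. *)
Definition off_torsion (P : maxIdeal A) : set Q :=
  [set v | exists2 s, ~ (P : set A) s & s *: v = 0].

Lemma submod_prime_torsion P : is_submodule (prime_torsion P).
Proof.
split; first exact: rpred0.
  by move=> x y; exact: rpredD.
by move=> a x; exact: rpredZ.
Qed.

Lemma submod_off_torsion P : is_submodule (off_torsion P).
Proof.
split; first by exists 1; [exact: max_ideal_nP1|rewrite scaler0].
- move=> x y [s Ps sx] [t Pt ty]; exists (s * t); first exact: max_idealNM.
  have -> : (s * t) *: (x + y) = t *: (s *: x) + s *: (t *: y).
    by rewrite scalerDr !scalerA [t * s]mulrC.
  by rewrite sx ty !scaler0 addr0.
- move=> a x [s Ps sx]; exists s => //.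
  by rewrite scalerA mulrC -scalerA sx scaler0.
Qed.

(* [y = (1 - t * s) y + t * s y] with [1 - t * s] in [P ^ n] splits [y] as soon
   as [P ^ n] kills [s y]. *)
Lemma torsion_split (P : maxIdeal A) (N : set Q) s n y : is_submodule N -> N y ->
  ~ (P : set A) s -> (forall b, ideal_pow P n b -> b *: (s *: y) = 0) ->
  add_set (N `&` prime_torsion P) (N `&` off_torsion P) y.
Proof.
move=> hN Ny Ps hs; have [t ht] := max_ideal_pow_inv n Ps.
exists (t *: (s *: y)).
  split; first by apply: submodZ => //; exact: submodZ.
  apply/asboolP; exists n => b hb.
  by rewrite scalerA mulrC -scalerA hs // scaler0.
exists ((1 - t * s) *: y); last first.
  by rewrite scalerBl scale1r -scalerA addrC subrK.
split; first exact: submodZ.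
by exists s => //; rewrite scalerA mulrC -scalerA hs.
Qed.

(** Otherwise some [y] outside of the sum [X] has a maximal ideal of multipliers into [X]. In each
    of the two cases, this ideal being [P] or not, a multiple of [y] by an element outside of [P] is
    killed by a power of [P], so [y] splits. *)
Lemma torsion_decomposition (P : maxIdeal A) (N : set Q) : is_submodule N ->
  N `<=` add_set (N `&` prime_torsion P) (N `&` off_torsion P).
Proof.
move=> hN; apply: contrapT; set X := add_set _ _ => NX.
have hX : is_submodule X.
  by apply: submod_add; apply: submodI => //;
    [exact: submod_prime_torsion|exact: submod_off_torsion].
have Xsplit v : X v -> exists s n, ~ (P : set A) s /\
    forall b, ideal_pow P n b -> b *: (s *: v) = 0.
  move=> [u [_ /asboolP[n hu]] [w [_ [s Ps sw]] <-]]; exists s, n; split=> // b hb.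
  by rewrite [s *: (u + w)]scalerDr sw addr0 scalerA mulrC -scalerA hu // scaler0.
have [y [Ny Xy ymax]] := artinian_maximal_ideal hX hN NX.
have [PI|nPI] := pselect ((P : set A) `<=` [set a | X (a *: y)]); last first.
  have [I1 hI I2] := ymax; have [hP P1 Pmax] := max_idealP P.
  have [IP|nIP] := pselect ([set a | X (a *: y)] `<=` (P : set A)).
    have [PE|PE] := I2 _ hP IP; last by apply: P1; rewrite PE.
    by apply: nPI; rewrite PE.
  have [a Xa Pa] : exists2 a, X (a *: y) & ~ (P : set A) a.
    by apply: contrapT => h; apply: nIP => a Xa; apply: contrapT => Pa; apply: h; exists a.
  have [s [n [Ps hs]]] := Xsplit _ Xa.
  apply: Xy; apply: (@torsion_split P N (s * a) n) => //; first exact: max_idealNM.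
  by move=> b hb; rewrite -[(s * a) *: y]scalerA hs.
have [gs [gsP hgs]] := maxIdeal_generators P nA.
(* A common [s] and [n] for the finitely many generators of [P] give [P ^ n] killing
   [s *: (g *: y)], so that [P ^ n.+1] kills [s *: y]. *)
have [s [n [Ps hs]]] : exists s n, ~ (P : set A) s /\
    forall g, g \in gs -> forall b, ideal_pow P n b -> b *: (s *: (g *: y)) = 0.
  elim: (gs) gsP => [_|g l IHl gP].
    by exists 1, 0%N; split=> //; exact: max_ideal_nP1.
  have [|s [n [Ps hs]]] := IHl; first by move=> h hl; apply: gP; rewrite inE hl orbT.
  have [t [m [Pt ht]]] := Xsplit _ (PI _ (gP g (mem_head _ _))).
  exists (s * t), (maxn n m); split; first exact: max_idealNM.
  move=> h; rewrite inE => /orP[/eqP->|hl] b hb.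
    rewrite -scalerA scalerA mulrC -scalerA ht ?scaler0 //.
    exact: ideal_pow_le (leq_maxr n m) _ hb.
  rewrite [s * t]mulrC -[(t * s) *: _]scalerA scalerA mulrC -scalerA hs ?scaler0 //.
  exact: ideal_pow_le (leq_maxl n m) _ hb.
apply: Xy; apply: (@torsion_split P N s n.+1) => // b hb.
apply: (hb [set b | b *: (s *: y) = 0]); split.
  split=> /= [|c d hc hd|c d hd]; first exact: scale0r.
    by rewrite scalerDl hc hd addr0.
  by rewrite -[c *: d]/(c * d) -scalerA hd scaler0.
move=> _ [i Pi [c hc <-]] /=; rewrite -scalerA.
apply: (hgs Q _ _ i Pi) => g ggs; rewrite -[RHS](hs g ggs c hc) !scalerA.
by congr (_ *: _); ring.
Qed.

Lemma omega2_prime_chain : has_omega2_chain Q ->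
  exists P : maxIdeal A, associated_prime Q P /\
    exists2 E : lmodType (completed_localization P), residue_hull E &
      prime_chain (annihilator (hom (completed_component P Q) E)) 2.
Proof.
move=> /omega2_not_tame ntQ; have tC := @tame_additive _ Q.
have [C0 CS CD] := tC.
have [N mN _] := minimal_not_ex aQ (@submodT _ _) ntQ; have [hN ntN Nmin] := mN.
have [|x [Nx x0 xmax]] := artinian_maximal_ideal (@submod_zero _ _) hN.
  by move=> N0; apply: ntN; exact: CS C0.
pose P := MaxIdeal xmax; exists P; split.
  by split; [exact: max_ideal_prime|exists x].
have hN1 := submodI hN (submod_prime_torsion P).
have hN2 := submodI hN (submod_off_torsion P).
(* The element [x], killed exactly by [P], is not in this submodule, which is therefore proper in
   [N], hence tame. Since [N] is not tame, its [P]-primary part is not either, and equals [N] by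
   minimality. *)
have tN2 : tame (N `&` off_torsion P).
  apply: contrapT => /(Nmin _ hN2 (@subIsetl _ _ _)) e.
  by move: Nx; rewrite -e => -[_ [s Ps sx]]; apply: Ps.
have NP : N `<=` prime_torsion P.
  suff <- : N `&` prime_torsion P = N by move=> v [].
  apply: Nmin => // tN1; apply: ntN.
  apply: (CS _ _ (torsion_decomposition P hN)); exact: CD.
pose V := completed_component P Q; pose N' := [set v : component P Q | N (val v)].
have hN' : @is_submodule _ V N'.
  apply/(@completed_submodule A P Q N'); split.
  - exact: (submod0 hN).
  - by move=> u v; exact: (submodD hN).
  - by move=> a v; exact: (submodZ a hN).
have ntN' : ~ @tame _ V N'.
  move=> tN'; apply: ntN => c hc cN cS cT.
  have [||||i0 st] := tN' (fun i j => [set v : component P Q | c i j (val v)]).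
  - move=> i j; apply/completed_submodule; split.
    + exact: (submod0 (hc i j)).
    + by move=> u v; exact: (submodD (hc i j)).
    + by move=> a v; exact: (submodZ a (hc i j)).
  - by move=> i j v; exact: cN.
  - by move=> i j v; exact: cS.
  - by move=> i j v; exact: cT.
  exists i0 => i /st[n hn]; exists n => m nm; apply/seteqP; split; last first.
    exact: chain_le (cS i) _ _ nm.
  move=> v cv; pose v' : component P Q := exist _ v (NP v (cN _ _ _ cv)).
  by have := congr1 (fun X : set (component P Q) => X v') (hn m nm) => /= <-.
have xP : prime_torsion P x := NP x Nx.
pose x' : component P Q := exist _ x xP.
have Px' g : (P : set A) g -> g *: x' = 0 by move=> /= gx; exact: val_inj.
(* The socle element [x] also provides the residue field, hence an injective hull [E]. *)
have [|||E hE] := @residue_hull_ex _ V x'.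
- by move=> /(congr1 val)/x0.
- exact: completed_simple.
- by move=> r /completed_nonunit_nil; exact.
exists E => //; have [p [hp pS]] := component_not_tame_chain nA aQ hN' ntN'.
exists p; split=> // i i2; have [pi Vp] := hp i i2.
by split=> //; apply: subset_trans Vp; exact: annihilator_hom.
Qed.

Lemma prime_chain_omega2 (P : maxIdeal A) (E : lmodType (completed_localization P)) :
  prime_chain (annihilator (hom (completed_component P Q) E)) 2 ->
  has_omega2_chain Q.
Proof.
move=> [p [hp pS]]; apply: (@component_chain_omega2 A P Q aQ).
exists p; split=> // i i2; have [pi Hp] := hp i i2; split=> //.
apply: subset_trans Hp => a ha f; apply: val_inj; apply/funext => v.
by rewrite hom_scaleE -homZ ha hom0.
Qed.

Lemma artinian_loewy_dim_le1 :
  (artinian_loewy_dim Q <= 1%:E)%E <-> ~ has_omega2_chain Q.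
Proof.
rewrite supremum_bar_int_le; split=> [h /omega2_prime_chain[P [aP [E hE pc]]]|h].
  have /krull_dim_le1 := h (krull_dim (hom (completed_component P Q) E))
    (ex_intro _ P (conj aP (ex_intro2 _ _ E hE erefl))).
  exact.
move=> _ [P [_ [E _ ->]]]; apply/krull_dim_le1 => pc.
by apply: h; exact: prime_chain_omega2 pc.
Qed.

End Reduction.

Theorem corollary3p14 (A : comPzRingType) (M : lmodType A)
    (hA : noetherian_ring A) :
  property_L2 M <-> (loewy_dim M <= 1%:E)%E.
Proof.
rewrite supremum_bar_int_le; split=> [L2 _ [Q [f [fs aQ ->]]]|h Q f fs aQ].
  by apply/artinian_loewy_dim_le1 => //; exact: L2 fs aQ.
apply/(artinian_loewy_dim_le1 hA aQ); apply: h; exists Q, f; split=> //.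
Qed.
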